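(* For $n\ge1$ let $\sigma_n(t)=H_n(t)+c_1t+c_2$ with $c_1=-n(n+\alpha+\beta+\gamma)-\frac{(\alpha+\beta)^2}{4}$ and $c_2=\frac14\left[2n(n+\alpha+\beta+\gamma)+(\alpha+\beta)\beta-(\alpha-\beta)\gamma\right]$. Then for $t\in(0,1)$, $\sigma_n$ satisfies the Jimbo–Miwa–Okamoto $\sigma$-form of Painlevé VI $$\sigma_n'\big[t(t-1)\sigma_n''\big]^2+\big[2\sigma_n'(t\sigma_n'-\sigma_n)-(\sigma_n')^2-\nu_1\nu_2\nu_3\nu_4\big]^2=\prod_{k=1}^4(\sigma_n'+\nu_k^2),$$ with $\nu_1=\frac{\alpha+\beta}{2}$, $\nu_2=\frac{\beta-\alpha}{2}$, $\nu_3=\frac{2n+\alpha+\beta}{2}$, $\nu_4=\frac{2n+\alpha+\beta+2\gamma}{2}$.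
   Context: Fix $\alpha,\beta,\gamma>0$ and real constants $A,B$ with $A\ge0$, $A+B\ge0$, not both $A$ and $A+B$ equal to $0$. Let $\theta$ be the Heaviside function ($\theta(x)=1$ for $x>0$, $0$ otherwise). For $t\in(0,1)$ put $w(x,t)=x^{\alpha}(1-x)^{\beta}|x-t|^{\gamma}(A+B\theta(x-t))$ on $[0,1]$, let $D_n(t)=\det\left(\int_0^1x^{i+j}w(x,t)dx\right)_{i,j=0}^{n-1}$, and $H_n(t)=t(t-1)\frac{d}{dt}\ln D_n(t)$. *)

(* Defs.v *)
From Stdlib Require Import Reals Lra Lia Classical ClassicalEpsilon.
Open Scope R_scope.

(* Riemann integral of f over [a,b] as a total function: the common value of
   RiemannInt pr for any integrability proof pr (independent of pr by
   RiemannInt_P5); junk (unspecified) value if f is not integrable. *)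
Definition RInt (f : R -> R) (a b : R) : R :=
  epsilon (inhabits 0) (fun v => exists pr : Riemann_integrable f a b, RiemannInt pr = v).

Definition heaviside (x : R) : R := if Rlt_dec 0 x then 1 else 0.

(* Real power y^a for y > 0; set to 0 for y <= 0 (only used where y = 0 at isolated
   points, which does not affect integrals). *)
Definition rpow (y a : R) : R := if Rlt_dec 0 y then Rpower y a else 0.

Definition weight (al be ga A B t x : R) : R :=
  rpow x al * rpow (1 - x) be * rpow (Rabs (x - t)) ga * (A + B * heaviside (x - t)).

Definition moment (al be ga A B t : R) (k : nat) : R :=
  RInt (fun x => x ^ k * weight al be ga A B t x) 0 1.

Fixpoint det (n : nat) (M : nat -> nat -> R) {struct n} : R :=
  match n with
  | O => 1
  | S m => sum_f_R0 (fun j => (-1) ^ j * M O j *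
             det m (fun i k => M (S i) (if Nat.ltb k j then k else S k))) m
  end.

Definition Dn (al be ga A B : R) (n : nat) (t : R) : R :=
  det n (fun i j => moment al be ga A B t (i + j)).

(* Main.v *)
(* Let L be integration against the weight w and P_n its monic orthogonal polynomials. The pair
   (P_n, P_(n-1)) satisfies a Fuchsian linear system in x with poles 0, 1, t whose residue
   matrices are built from the values at each pole of the polynomials and of their functions of
   the second kind. Three facts are needed. The residues have constant determinants and their sum is a constant
   diagonal matrix (static relations, from integrating w' against P_n^2, P_n P_(n-1), P_(n-1)^2);
   differentiating in t gives the Schlesinger equation for one diagonal entry; and H_n is an affine
   function of the subleading coefficient of P_n, which is in turn affine in the residue entries.
   Then sigma' is affine in a diagonal entry, sigma'' is up to a factor the triple product
   tr (a [b, c]) of the residues, and the sigma form is the identity equating the square of the triple product with the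
   Gram determinant of the trace form.

   For small gamma the weight is not differentiable in t; integrating by parts expresses its
   moments by those with gamma + 1, which are. *)
Require Import Defs.
From Stdlib Require Import Reals Lra Lia ClassicalEpsilon.
From HB Require structures.
From mathcomp Require all_boot all_order all_algebra ring Rstruct.
From Coquelicot Require Import Coquelicot.
Open Scope R_scope.

(** * Moments of the weight *)

Lemma rpow_pos_eq y a : 0 < y -> rpow y a = Rpower y a.
Proof. intros Hy; unfold rpow; destruct (Rlt_dec 0 y); [reflexivity|contradiction]. Qed.

Lemma rpow_nonpos y a : y <= 0 -> rpow y a = 0.
Proof. intros Hy; unfold rpow; destruct (Rlt_dec 0 y); [lra|reflexivity]. Qed.

Lemma rpow_gt0 y a : 0 < y -> 0 < rpow y a.
Proof. intros Hy; rewrite rpow_pos_eq by assumption; apply exp_pos. Qed.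

Lemma rpow_ge0 y a : 0 <= rpow y a.
Proof.
  destruct (Rlt_dec 0 y) as [Hy|Hy].
  - now apply Rlt_le, rpow_gt0.
  - rewrite rpow_nonpos by lra; lra.
Qed.

(** Valid on the whole line because both sides vanish for [y <= 0]; a factor [y] can thus be
    absorbed into a truncated power without splitting cases. *)
Lemma rpow_succ y a : rpow y (a + 1) = y * rpow y a.
Proof.
  destruct (Rlt_dec 0 y) as [Hy|Hy].
  - rewrite !rpow_pos_eq by assumption.
    rewrite Rpower_plus, Rpower_1 by assumption; ring.
  - rewrite !rpow_nonpos by lra; ring.
Qed.

Lemma continuous_rpow a y : 0 < a -> continuous (fun y => rpow y a) y.
Proof.
  intros Ha.
  destruct (Rtotal_order y 0) as [Hy|[->|Hy]].
  - apply continuous_ext_loc with (fun _ => 0); [|apply continuous_const].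
    exists (mkposreal (- y) ltac:(lra)); intros z Hz.
    change (Rabs (z - y) < - y) in Hz; apply Rabs_def2 in Hz.
    symmetry; apply rpow_nonpos; lra.
  - apply continuity_pt_filterlim; intros eps Heps.
    exists (Rpower eps (/ a)); split; [apply exp_pos|].
    intros z [_ Hz]; simpl in *; unfold Rdist in *.
    rewrite (rpow_nonpos 0) by lra; rewrite Rminus_0_r in *.
    rewrite Rabs_pos_eq by apply rpow_ge0.
    destruct (Rlt_dec 0 z) as [Hz0|Hz0]; [|rewrite rpow_nonpos; lra].
    rewrite Rabs_pos_eq in Hz by lra.
    rewrite rpow_pos_eq by assumption.
    replace eps with (Rpower (Rpower eps (/ a)) a).
    + apply Rlt_Rpower_l; lra.
    + rewrite Rpower_mult, Rinv_l, Rpower_1; lra.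
  - apply continuous_ext_loc with (fun z => exp (a * ln z)).
    + exists (mkposreal y Hy); intros z Hz.
      change (Rabs (z - y) < y) in Hz; apply Rabs_def2 in Hz.
      symmetry; apply rpow_pos_eq; lra.
    + apply (ex_derive_continuous (fun z => exp (a * ln z))).
      auto_derive; assumption.
Qed.

(** With [a > 0] the formula also holds at 0, where the difference quotient is [rpow z a] and tends
    to 0. *)
Lemma is_derive_rpow a y :
  0 < a -> is_derive (fun y => rpow y (a + 1)) y ((a + 1) * rpow y a).
Proof.
  intros Ha.
  destruct (Rtotal_order y 0) as [Hy|[->|Hy]].
  - rewrite rpow_nonpos, Rmult_0_r by lra.
    apply is_derive_ext_loc with (fun _ => 0); [|auto_derive; trivial].
    exists (mkposreal (- y) ltac:(lra)); intros z Hz.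
    change (Rabs (z - y) < - y) in Hz; apply Rabs_def2 in Hz.
    symmetry; apply rpow_nonpos; lra.
  - rewrite rpow_nonpos, Rmult_0_r by lra.
    apply is_derive_Reals; intros eps Heps.
    destruct (proj2 (continuity_pt_filterlim _ _) (continuous_rpow a 0 Ha) eps Heps)
      as [d [Hd H]].
    exists (mkposreal d Hd); intros z Hz0 Hz.
    rewrite Rplus_0_l, !rpow_succ, Rmult_0_l, !Rminus_0_r.
    replace (z * rpow z a / z) with (rpow z a) by (field; assumption).
    specialize (H z); simpl in H; unfold Rdist, D_x, no_cond in H.
    rewrite (rpow_nonpos 0), !Rminus_0_r in H by lra.
    apply H; repeat split; auto.
  - apply is_derive_ext_loc with (fun z => exp ((a + 1) * ln z)).
    + exists (mkposreal y Hy); intros z Hz.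
      change (Rabs (z - y) < y) in Hz; apply Rabs_def2 in Hz.
      symmetry; apply rpow_pos_eq; lra.
    + assert (E : rpow y a * y = exp ((a + 1) * ln y)).
      { change (exp ((a + 1) * ln y)) with (Rpower y (a + 1)).
        rewrite <- rpow_pos_eq, rpow_succ by assumption; ring. }
      auto_derive; [assumption|]; rewrite <- E; field; lra.
Qed.

Local Ltac real_ring :=
  lazymatch goal with |- @eq _ ?a ?b => change (@eq R a b) end; ring.

Section Moments.

Variables al be ga A B : R.
Hypotheses (Hal : 0 < al) (Hbe : 0 < be) (Hga : 0 < ga).
Hypotheses (HA : 0 <= A) (HAB : 0 <= A + B) (Hnz : ~ (A = 0 /\ A + B = 0)).

Definition jac (x : R) : R := rpow x al * rpow (1 - x) be.

(** The factor of the weight that depends on [t], split into two truncated powers so that the facts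
    on [rpow] apply on each side of the jump. *)
Definition jump (y : R) : R := A * rpow (- y) ga + (A + B) * rpow y ga.

Lemma weight_eq t x : weight al be ga A B t x = jac x * jump (x - t).
Proof.
  unfold weight, jac, jump, heaviside; rewrite Rmult_assoc; f_equal.
  destruct (Rlt_dec 0 (x - t)) as [H|H].
  - rewrite (rpow_nonpos (- (x - t))), Rabs_pos_eq by lra; real_ring.
  - rewrite (rpow_nonpos (x - t)), Rabs_left1 by lra; real_ring.
Qed.

Lemma continuous_jac x : continuous jac x.
Proof.
  apply (continuous_mult (K := R_AbsRing)); [now apply continuous_rpow|].
  apply (continuous_comp (fun x => 1 - x) (fun y => rpow y be)).
  - apply (continuous_minus (V := R_NormedModule));
      [apply continuous_const|apply continuous_id].
  - now apply continuous_rpow.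
Qed.

Lemma continuous_jump y : continuous jump y.
Proof.
  apply (continuous_plus (V := R_NormedModule)); apply (continuous_scal_r (V := R_NormedModule)).
  - apply (continuous_comp Ropp (fun y => rpow y ga)).
    + apply (continuous_opp (V := R_NormedModule)), continuous_id.
    + now apply continuous_rpow.
  - now apply continuous_rpow.
Qed.

Lemma continuous_weight t x : continuous (weight al be ga A B t) x.
Proof.
  apply continuous_ext with (fun x => jac x * jump (x - t));
    [intros; symmetry; apply weight_eq|].
  apply (continuous_mult (K := R_AbsRing)); [apply continuous_jac|].
  apply (continuous_comp (fun x => x - t) jump); [|apply continuous_jump].
  apply (continuous_minus (V := R_NormedModule));
      [apply continuous_id|apply continuous_const].
Qed.

(** Multiplication by [y] raises the exponent to [ga + 1] on both sides of 0, with a sign change on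
    the left; the product is C^1 even for [ga < 1]. *)
Lemma jump_primitive y :
  is_derive (fun y => y * jump y) y ((ga + 1) * jump y).
Proof.
  apply is_derive_ext with
    (fun y => - A * rpow (- y) (ga + 1) + (A + B) * rpow y (ga + 1)).
  - intros z; unfold jump; rewrite !rpow_succ; real_ring.
  - unfold jump.
    replace ((ga + 1) * (A * rpow (- y) ga + (A + B) * rpow y ga)) with
      (- A * (- 1 * ((ga + 1) * rpow (- y) ga)) + (A + B) * ((ga + 1) * rpow y ga)) by real_ring.
    apply (is_derive_plus (V := R_NormedModule)); apply (is_derive_scal).
    + apply (is_derive_comp (V := R_NormedModule) (fun y => rpow y (ga + 1)) Ropp).
      * now apply is_derive_rpow.
      * assert (H : is_derive (fun y => - y) y (- 1)) by (auto_derive; [trivial|real_ring]).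
        exact H.
    + now apply is_derive_rpow.
Qed.

Lemma Defs_RInt_eq f :
  (forall x, continuous f x) -> Defs.RInt f 0 1 = RInt f 0 1.
Proof.
  intros Hf.
  assert (Hi : ex_RInt f 0 1) by (apply (ex_RInt_continuous (V := R_CompleteNormedModule)); auto).
  assert (H : exists v, exists pr : Riemann_integrable f 0 1, RiemannInt pr = v).
  { eexists; exists (ex_RInt_Reals_0 _ _ _ Hi); reflexivity. }
  destruct (epsilon_spec (inhabits 0) _ H) as [pr Hpr].
  unfold Defs.RInt; rewrite <- Hpr; symmetry; apply RInt_Reals.
Qed.

Lemma continuous_pow k x : continuous (fun x => x ^ k) x.
Proof. apply (ex_derive_continuous (fun x => x ^ k)); auto_derive; trivial. Qed.

Let mom := moment al be ga A B.

Lemma moment_eq t k :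
  mom t k = RInt (fun x => x ^ k * (jac x * jump (x - t))) 0 1.
Proof.
  unfold mom, moment; rewrite Defs_RInt_eq.
  - apply RInt_ext; intros x _; now rewrite weight_eq.
  - intros x; apply (continuous_mult (K := R_AbsRing));
      [apply continuous_pow|apply continuous_weight].
Qed.

Lemma continuous_shift_jump t x : continuous (fun x => jump (x - t)) x.
Proof.
  apply (continuous_comp (fun x => x - t) jump); [|apply continuous_jump].
  apply (continuous_minus (V := R_NormedModule));
      [apply continuous_id|apply continuous_const].
Qed.

Lemma continuous_integrand t k x :
  continuous (fun x => x ^ k * (jac x * jump (x - t))) x.
Proof.
  apply (continuous_mult (K := R_AbsRing)); [apply continuous_pow|].
  apply (continuous_mult (K := R_AbsRing));
    [apply continuous_jac|apply continuous_shift_jump].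
Qed.

Lemma is_RInt_moment t k :
  is_RInt (fun x => x ^ k * (jac x * jump (x - t))) 0 1 (mom t k).
Proof.
  rewrite moment_eq; apply (RInt_correct (V := R_CompleteNormedModule)).
  apply (ex_RInt_continuous (V := R_CompleteNormedModule)).
  intros; apply continuous_integrand.
Qed.

Lemma is_RInt_shifted_moment t k :
  is_RInt (fun x => x ^ k * jac x * ((x - t) * jump (x - t))) 0 1
    (mom t (S k) - t * mom t k).
Proof.
  apply is_RInt_ext with (fun x => x ^ (S k) * (jac x * jump (x - t))
     - t * (x ^ k * (jac x * jump (x - t)))).
  - intros x _; simpl; real_ring.
  - apply (is_RInt_minus (V := R_NormedModule)); [apply is_RInt_moment|].
    apply (is_RInt_scal (V := R_NormedModule)), is_RInt_moment.
Qed.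

Lemma continuity_2d_pt_snd f t x :
  continuous f x -> continuity_2d_pt (fun _ y => f y) t x.
Proof.
  intros Hf; apply continuity_2d_pt_filterlim.
  apply (continuous_comp (fun z : R * R => snd z) f); [apply continuous_snd|exact Hf].
Qed.

(** Differentiation under the integral sign is legitimate because the factor [x - t] makes the
    integrand C^1 in [t]. *)
Lemma shifted_moment_derive t k :
  is_derive (fun t => mom t (S k) - t * mom t k) t (- (ga + 1) * mom t k).
Proof.
  set (F := fun u x => x ^ k * jac x * ((x - u) * jump (x - u))).
  set (dF := fun u x => - (ga + 1) * (x ^ k * (jac x * jump (x - u)))).
  assert (HF : forall u x, is_derive (fun u => F u x) u (dF u x)).
  { intros u x; unfold F, dF.
    replace (- (ga + 1) * (x ^ k * (jac x * jump (x - u)))) with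
      (x ^ k * jac x * (- 1 * ((ga + 1) * jump (x - u)))) by real_ring.
    apply is_derive_scal.
    apply (is_derive_comp (V := R_NormedModule) (fun y => y * jump y) (fun u => x - u)).
    - apply jump_primitive.
    - assert (H : is_derive (fun u => x - u) u (- 1)) by (auto_derive; [trivial|real_ring]).
      exact H. }
  apply is_derive_ext with (fun u => RInt (fun x => F u x) 0 1).
  { intros u; apply is_RInt_unique, is_RInt_shifted_moment. }
  replace (- (ga + 1) * mom t k) with (RInt (fun x => Derive (fun u => F u x) t) 0 1).
  - apply is_derive_RInt_param.
    + apply filter_forall; intros u x _; eexists; apply HF.
    + intros x _; apply continuity_2d_pt_ext with (fun u x => dF u x).
      { intros u y; symmetry; apply is_derive_unique, HF. }
      unfold dF; apply continuity_2d_pt_mult; [apply continuity_2d_pt_const|].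
      apply continuity_2d_pt_mult;
        [apply (continuity_2d_pt_snd (fun x => x ^ k)), continuous_pow|].
      apply continuity_2d_pt_mult;
        [apply (continuity_2d_pt_snd jac), continuous_jac|].
      apply (continuity_1d_2d_pt_comp jump (fun u v => v - u)).
      * apply continuity_pt_filterlim, continuous_jump.
      * apply continuity_2d_pt_minus;
          [apply continuity_2d_pt_id2|apply continuity_2d_pt_id1].
    + apply filter_forall; intros u; eexists; apply is_RInt_shifted_moment.
  - apply is_RInt_unique.
    apply is_RInt_ext with (fun x => dF t x).
    { intros x _; symmetry; apply is_derive_unique, HF. }
    apply (is_RInt_scal (V := R_NormedModule)), is_RInt_moment.
Qed.

(* Integrate the derivative of
   [x ^ k * rpow x (al + 1) * rpow (1 - x) (be + 1) * (x - t) * jump (x - t)],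
   which vanishes at both ends; all the exponents exceed 1, so this function is C^1 even
   when [ga < 1]. *)
Lemma shifted_moment_recurrence t k :
  let M j := mom t (S j) - t * mom t j in
  t * (1 - t) * (ga + 1) * mom t k =
  - (INR k + 1 + al + (ga + 1) * (1 - t)) * M k
  + (INR k + 3 + al + be + ga) * M (S k).
Proof.
  intros M.
  set (a x := rpow x (al + 1)); set (b x := rpow (1 - x) (be + 1)).
  set (psi x := (x - t) * jump (x - t)).
  set (p1 x := (INR k + al + 1) * x ^ k * (1 - x) - (be + 1) * x ^ S k).
  set (p2 x := (ga + 1) * x ^ S k * (1 - x)).
  set (dG x := p1 x * (jac x * psi x) + p2 x * (jac x * jump (x - t))).
  assert (HG : forall x, is_derive (fun x => x ^ k * a x * b x * psi x) x (dG x)).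
  { intros x.
    assert (Ha : is_derive a x ((al + 1) * rpow x al)) by now apply is_derive_rpow.
    assert (Hb : is_derive b x (- 1 * ((be + 1) * rpow (1 - x) be))).
    { apply (is_derive_comp (V := R_NormedModule) (fun y => rpow y (be + 1)) (fun x => 1 - x)).
      - now apply is_derive_rpow.
      - assert (H : is_derive (fun x => 1 - x) x (- 1)) by (auto_derive; [trivial|real_ring]).
        exact H. }
    assert (Hp : is_derive psi x (1 * ((ga + 1) * jump (x - t)))).
    { apply (is_derive_comp (V := R_NormedModule) (fun y => y * jump y) (fun x => x - t)).
      - apply jump_primitive.
      - assert (H : is_derive (fun x => x - t) x 1) by (auto_derive; [trivial|real_ring]).
        exact H. }
    assert (Hk : is_derive (fun x => x ^ k) x (INR k * x ^ pred k))
      by (auto_derive; [trivial|real_ring]).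
    assert (Hkx : INR k * x ^ pred k * x = INR k * x ^ k).
    { destruct k; [simpl; ring|]; simpl pred; simpl pow; real_ring. }
    replace (dG x) with
     (((INR k * x ^ pred k * a x + x ^ k * ((al + 1) * rpow x al)) * b x
       + x ^ k * a x * (- 1 * ((be + 1) * rpow (1 - x) be))) * psi x
       + x ^ k * a x * b x * (1 * ((ga + 1) * jump (x - t)))).
    - assert (Hmul : forall f g df dg, is_derive f x df -> is_derive g x dg ->
        is_derive (fun x => f x * g x) x (df * g x + f x * dg)).
      { intros f g df dg Hf Hg; exact (is_derive_mult f g x df dg Hf Hg Rmult_comm). }
      repeat apply Hmul; assumption.
    - unfold dG, p1, p2, a, b, jac; rewrite !rpow_succ.
      apply Rminus_diag_uniq.
      transitivity ((INR k * x ^ pred k * x - INR k * x ^ k)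
        * (rpow x al * ((1 - x) * rpow (1 - x) be) * psi x)).
      + simpl pow; unfold psi; ring.
      + rewrite Hkx; ring. }
  assert (H0 : is_RInt dG 0 1 0).
  { assert (E0 : minus (1 ^ k * a 1 * b 1 * psi 1) (0 ^ k * a 0 * b 0 * psi 0) = 0).
    { change (1 ^ k * a 1 * b 1 * psi 1 - 0 ^ k * a 0 * b 0 * psi 0 = 0).
      unfold a, b; rewrite Rminus_diag, !(rpow_nonpos 0) by lra; ring. }
    refine (eq_ind _ (is_RInt dG 0 1) _ _ E0).
    apply (is_RInt_derive (V := R_CompleteNormedModule)
             (fun x => x ^ k * a x * b x * psi x)); [intros; apply HG|].
    intros x _.
    assert (Cj := continuous_jac x); assert (Cs := continuous_shift_jump t x).
    assert (Hmul : forall f g : R -> R, continuous f x -> continuous g x ->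
      continuous (fun x => f x * g x) x)
      by (intros; now apply (continuous_mult (K := R_AbsRing))).
    assert (Hpol : forall f : R -> R, ex_derive f x -> continuous f x)
      by (intros; now apply (ex_derive_continuous (V := R_NormedModule))).
    apply (continuous_plus (V := R_NormedModule)); apply Hmul.
    - apply Hpol; unfold p1; auto_derive; trivial.
    - apply Hmul; [exact Cj|].
      apply Hmul; [apply Hpol; auto_derive; trivial|exact Cs].
    - apply Hpol; unfold p2; auto_derive; trivial.
    - apply Hmul; [exact Cj|exact Cs]. }
  (* The identity [x (1 - x) = t (1 - t) + (x - t) (1 - t - x)] turns the [p2] term into a plain
     moment plus shifted ones. *)
  assert (H1 : is_RInt dG 0 1
    ((INR k + al + 1 + (ga + 1) * (1 - t)) * M k
     + (- (INR k + 3 + al + be + ga) * M (S k)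
     + (ga + 1) * t * (1 - t) * mom t k))).
  { apply is_RInt_ext with (fun x =>
      (INR k + al + 1 + (ga + 1) * (1 - t)) * (x ^ k * jac x * ((x - t) * jump (x - t)))
      + (- (INR k + 3 + al + be + ga) * (x ^ S k * jac x * ((x - t) * jump (x - t)))
         + (ga + 1) * t * (1 - t) * (x ^ k * (jac x * jump (x - t))))).
    - intros x _; unfold dG, p1, p2, psi; simpl pow; real_ring.
    - apply (is_RInt_plus (V := R_NormedModule));
        [|apply (is_RInt_plus (V := R_NormedModule))];
        apply (is_RInt_scal (V := R_NormedModule)).
      + apply is_RInt_shifted_moment.
      + apply is_RInt_shifted_moment.
      + apply is_RInt_moment. }
  assert (E := is_RInt_unique _ _ _ _ H1); rewrite (is_RInt_unique _ _ _ _ H0) in E.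
  lra.
Qed.

(** Formally the moment of [- ga w / (x - t)], freed of the singular factor by integrating the
    derivative of [x ^ (k + 1) (1 - x) w]. *)
Definition dmoment t k : R :=
  ((INR k + 1 + al + ga - ga * t) * mom t k
   - (INR k + 2 + al + be + ga) * mom t (S k)) / (t * (1 - t)).

Lemma moment_derive t k : 0 < t < 1 -> is_derive (fun t => mom t k) t (dmoment t k).
Proof.
  intros Ht.
  set (M j u := mom u (S j) - u * mom u j).
  set (c u := - (INR k + 1 + al + (ga + 1) * (1 - u))).
  set (d := INR k + 3 + al + be + ga).
  set (e u := u * (1 - u) * (ga + 1)).
  (* Divided by [e], the recurrence expresses the moment through shifted moments, whose derivatives
     are known. *)
  apply is_derive_ext_loc with (fun u => (c u * M k u + d * M (S k) u) / e u).
  { assert (Hd : 0 < Rmin t (1 - t)) by (apply Rmin_glb_lt; lra).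
    exists (mkposreal _ Hd); intros u Hu.
    change (Rabs (u - t) < Rmin t (1 - t)) in Hu; apply Rabs_def2 in Hu.
    assert (H1 := Rmin_l t (1 - t)); assert (H2 := Rmin_r t (1 - t)).
    assert (He : e u <> 0) by (unfold e; apply Rgt_not_eq;
       repeat apply Rmult_lt_0_compat; lra).
    apply Rmult_eq_reg_r with (e u); [|exact He].
    unfold Rdiv; rewrite Rmult_assoc, Rinv_l, Rmult_1_r by exact He.
    assert (E := shifted_moment_recurrence u k); cbv zeta in E.
    unfold c, d, M, e; rewrite (Rmult_comm (mom u k)), E; real_ring. }
  assert (He : e t <> 0) by (unfold e; apply Rgt_not_eq;
       repeat apply Rmult_lt_0_compat; lra).
  assert (HM : forall j, is_derive (M j) t (- (ga + 1) * mom t j))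
    by (intros; apply shifted_moment_derive).
  assert (Dc : is_derive c t (ga + 1)) by (unfold c; auto_derive; [trivial|real_ring]).
  assert (De : is_derive e t ((1 - 2 * t) * (ga + 1)))
    by (unfold e; auto_derive; [trivial|real_ring]).
  replace (dmoment t k) with
    ((((ga + 1) * M k t + c t * (- (ga + 1) * mom t k)
       + d * (- (ga + 1) * mom t (S k))) * e t
      - (c t * M k t + d * M (S k) t) * ((1 - 2 * t) * (ga + 1))) / e t ^ 2).
  - apply (is_derive_div (fun u => c u * M k u + d * M (S k) u) e); [|exact De|exact He].
    apply (is_derive_plus (V := R_NormedModule)).
    + exact (is_derive_mult c (M k) t _ _ Dc (HM k) Rmult_comm).
    + apply is_derive_scal, HM.
  - assert (E := shifted_moment_recurrence t k); cbv zeta in E.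
    replace (c t * M k t + d * M (S k) t) with (e t * mom t k)
      by (unfold e, c, d, M; rewrite E; ring).
    unfold dmoment, c, d, M, e; field; repeat split; lra.
Qed.

(** The derivative of a shifted moment is computed in two ways. *)
Lemma dmoment_succ t k :
  0 < t < 1 -> dmoment t (S k) = t * dmoment t k - ga * mom t k.
Proof.
  intros Ht.
  assert (H1 := shifted_moment_derive t k).
  assert (H2 : is_derive (fun t => mom t (S k) - t * mom t k) t
    (dmoment t (S k) - (1 * mom t k + t * dmoment t k))).
  { apply (is_derive_minus (V := R_NormedModule)); [now apply moment_derive|].
    refine (is_derive_mult (fun t => t) (fun t => mom t k) t _ _ _ _ Rmult_comm).
    - apply (is_derive_id (K := R_AbsRing)).
    - now apply moment_derive. }
  assert (E := is_derive_unique _ _ _ H1); rewrite (is_derive_unique _ _ _ H2) in E.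
  lra.
Qed.

(** One of [A] and [A + B] may vanish, so positivity is guaranteed on one side only. *)
Lemma jump_gt0 : (forall y, y < 0 -> 0 < jump y) \/ (forall y, 0 < y -> 0 < jump y).
Proof.
  destruct (Req_dec A 0) as [H0|H0]; [right|left]; intros y Hy; unfold jump.
  - rewrite (rpow_nonpos (- y)) by lra.
    assert (H := rpow_gt0 y ga Hy).
    assert (0 < (A + B) * rpow y ga); [apply Rmult_lt_0_compat; lra|lra].
  - rewrite (rpow_nonpos y) by lra.
    assert (H := rpow_gt0 (- y) ga ltac:(lra)).
    assert (0 < A * rpow (- y) ga); [apply Rmult_lt_0_compat; lra|lra].
Qed.

Lemma jump_ge0 y : 0 <= jump y.
Proof.
  unfold jump; apply Rplus_le_le_0_compat; apply Rmult_le_pos; auto using rpow_ge0.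
Qed.

Lemma jac_ge0 x : 0 <= jac x.
Proof. apply Rmult_le_pos; apply rpow_ge0. Qed.

Lemma jac_gt0 x : 0 < x < 1 -> 0 < jac x.
Proof. intros Hx; apply Rmult_lt_0_compat; apply rpow_gt0; lra. Qed.

Lemma RInt_gt0_pt f x0 :
  (forall x, continuous f x) -> (forall x, 0 <= f x) -> 0 < x0 < 1 -> 0 < f x0 ->
  0 < RInt f 0 1.
Proof.
  intros Hc Hp Hx H0.
  assert (Hi : forall a b, ex_RInt f a b)
    by (intros; apply (ex_RInt_continuous (V := R_CompleteNormedModule)); auto).
  destruct (proj2 (continuity_pt_filterlim _ _) (Hc x0) (f x0) H0) as [d [Hd H]].
  set (e := Rmin d (Rmin x0 (1 - x0)) / 2).
  assert (He : 0 < e /\ e < d /\ e < x0 /\ e < 1 - x0).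
  { unfold e; assert (0 < Rmin d (Rmin x0 (1 - x0)))
      by (repeat apply Rmin_glb_lt; lra).
    assert (Ha := Rmin_l d (Rmin x0 (1 - x0))); assert (Hb := Rmin_r d (Rmin x0 (1 - x0))).
    assert (Hc1 := Rmin_l x0 (1 - x0)); assert (Hc2 := Rmin_r x0 (1 - x0)); lra. }
  rewrite <- (RInt_Chasles f 0 (x0 - e) 1) by auto.
  rewrite <- (RInt_Chasles f (x0 - e) (x0 + e) 1) by auto.
  unfold plus; simpl.
  assert (0 <= RInt f 0 (x0 - e)) by (apply RInt_ge_0; [lra|auto|auto]).
  assert (0 <= RInt f (x0 + e) 1) by (apply RInt_ge_0; [lra|auto|auto]).
  assert (0 < RInt f (x0 - e) (x0 + e)).
  { apply RInt_gt_0; [lra| |auto]; intros x Hx1.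
    destruct (Req_dec x0 x) as [<-|Hne]; [exact H0|].
    assert (Hf : Rabs (f x - f x0) < f x0).
    { apply (H x); split; [split; [exact I|exact Hne]|].
      simpl; unfold Rdist; apply Rabs_def1; lra. }
    apply Rabs_def2 in Hf; lra. }
  lra.
Qed.

Lemma is_RInt_moment_sum (c : nat -> R) n t :
  is_RInt (fun x => sum_f_R0 (fun k => c k * x ^ k) n * (jac x * jump (x - t))) 0 1
    (sum_f_R0 (fun k => c k * mom t k) n).
Proof.
  induction n as [|n IH]; simpl sum_f_R0.
  - apply is_RInt_ext with (fun x => c O * (x ^ 0 * (jac x * jump (x - t))));
      [intros; simpl; ring|].
    apply (is_RInt_scal (V := R_NormedModule)), is_RInt_moment.
  - apply is_RInt_ext with (fun x =>
      sum_f_R0 (fun k => c k * x ^ k) n * (jac x * jump (x - t))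
      + c (S n) * (x ^ S n * (jac x * jump (x - t)))); [intros; simpl; ring|].
    apply (is_RInt_plus (V := R_NormedModule)); [exact IH|].
    apply (is_RInt_scal (V := R_NormedModule)), is_RInt_moment.
Qed.

(** Here [f] stands for a nonzero polynomial and [c] for the coefficients of its square. The point
    where the integrand is positive is sought on the side of [t] where the weight is. *)
Lemma moment_positive (c : nat -> R) n (f : R -> R) t :
  0 < t < 1 ->
  (forall x, sum_f_R0 (fun k => c k * x ^ k) n = f x * f x) ->
  (forall a b, a < b -> exists x, a < x < b /\ f x <> 0) ->
  0 < sum_f_R0 (fun k => c k * mom t k) n.
Proof.
  intros Ht Hf Hnv.
  assert (Hx : exists x0, 0 < x0 < 1 /\ f x0 <> 0 /\ 0 < jump (x0 - t)).
  { destruct jump_gt0 as [Hj|Hj].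
    - destruct (Hnv 0 t) as [x [Hx Hfx]]; [lra|].
      exists x; repeat split; try lra; apply Hj; lra.
    - destruct (Hnv t 1) as [x [Hx Hfx]]; [lra|].
      exists x; repeat split; try lra; apply Hj; lra. }
  destruct Hx as [x0 [Hx0 [Hfx Hj]]].
  rewrite <- (is_RInt_unique _ _ _ _ (is_RInt_moment_sum c n t)).
  apply RInt_gt0_pt with x0; [| |exact Hx0|].
  - intros x; apply (continuous_mult (K := R_AbsRing)).
    + apply continuity_pt_filterlim, continuity_finite_sum.
    + apply (continuous_mult (K := R_AbsRing));
        [apply continuous_jac|apply continuous_shift_jump].
  - intros x; rewrite Hf; apply Rmult_le_pos; [apply Rle_0_sqr|].
    apply Rmult_le_pos; [apply jac_ge0|apply jump_ge0].
  - rewrite Hf; apply Rmult_lt_0_compat; [now apply Rsqr_pos_lt|].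
    apply Rmult_lt_0_compat; [now apply jac_gt0|exact Hj].
Qed.

End Moments.

(** * The open unit interval and the differential system for the Hankel determinant *)

Definition in01 (t : R) : Prop := 0 < t < 1.

Lemma in01_neq0 t : in01 t -> t <> 0.
Proof. unfold in01; lra. Qed.

Lemma in01_neq1 t : in01 t -> 1 - t <> 0.
Proof. unfold in01; lra. Qed.

Lemma derivable_pt_lim_ext01 f g t a :
  (forall s, in01 s -> f s = g s) -> in01 t ->
  derivable_pt_lim f t a -> derivable_pt_lim g t a.
Proof.
  intros H Ht Hf; apply is_derive_Reals; apply is_derive_Reals in Hf.
  apply is_derive_ext_loc with f; [|exact Hf].
  assert (Hd : 0 < Rmin t (1 - t)) by (apply Rmin_glb_lt; unfold in01 in Ht; lra).
  exists (mkposreal _ Hd); intros u Hu; apply H.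
  change (Rabs (u - t) < Rmin t (1 - t)) in Hu; apply Rabs_def2 in Hu.
  assert (H1 := Rmin_l t (1 - t)); assert (H2 := Rmin_r t (1 - t)).
  unfold in01 in *; lra.
Qed.

(* [pp] is the coefficient of [x ^ (N - 1)] in the monic orthogonal polynomial of degree [N];
   [rho] and [rho0] are diagonal entries of the residue matrices at [t] and [0]. *)
Definition tau_equations al be ga (Df : R -> R) N (pp rho rho0 drho0 : R -> R) t :=
  derivable_pt_lim (fun s => ln (Df s)) t
    ((N * (N + al + ga - ga * t) + (2 * N + al + be + ga) * pp t) / (t * (1 - t))) /\
  derivable_pt_lim pp t (- rho t) /\
  derivable_pt_lim rho t (drho0 t / (1 - t)) /\
  pp t = - (rho0 t - rho t + N + t * rho t) /\
  (t * drho0 t) ^ 2 =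
  (2 * rho t * rho0 t - (al + be + 2 * N) * rho0 t + (ga + be + 2 * N) * rho t
     - N * (N + be)) ^ 2 - 4 * rho t * (rho t + ga) * rho0 t * (rho0 t - al).

Module OrthogonalPolynomials.
Import HB.structures all_boot all_order all_algebra ring Rstruct.
Import Order.TTheory GRing.Theory Num.Theory.
Local Open Scope ring_scope.
Set Implicit Arguments.
Unset Strict Implicit.
Unset Printing Implicit Defensive.

(** * Linear functionals on polynomials *)

Section Functionals.

Variable F : fieldType.
Implicit Types (m : nat -> F) (p q f g : {poly F}).

(** Deduces one equation from another: [ring] or [field] checks that the two differences are
    proportional with factor [c]. *)
Lemma eq_of_combination (c a b x y : F) : a = b -> x - y = c * (a - b) -> x = y.
Proof. by move=> ->; rewrite subrr mulr0 => /eqP; rewrite subr_eq0 => /eqP. Qed.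

(** A functional is given by its moments alone, so that singular weights such as [w / x] can be
    handled algebraically. *)
Definition lfun m p : F := \sum_(i < size p) p`_i * m i.

Lemma lfun_widen N m p : (size p <= N)%N -> lfun m p = \sum_(i < N) p`_i * m i.
Proof.
move=> le_pN; rewrite /lfun (big_ord_widen N (fun i => p`_i * m i)) // big_mkcond.
apply: eq_bigr => i _; case: ltnP => // le_pi.
by rewrite nth_default // mul0r.
Qed.

Lemma lfun_is_scalar m : scalar (lfun m).
Proof.
move=> a p q; set N := maxn (size (a *: p + q)) (maxn (size p) (size q)).
rewrite !(@lfun_widen N) ?leq_max ?leqnn ?orbT // mulr_sumr -big_split /=.
by apply: eq_bigr => i _; rewrite coefD coefZ mulrDl mulrA.
Qed.

HB.instance Definition _ m :=
  GRing.isLinear.Build F {poly F} F *%R (lfun m) (lfun_is_scalar m).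

Lemma lfunXn m k : lfun m 'X^k = m k.
Proof.
rewrite /lfun size_polyXn big_ord_recr /= coefXn eqxx mul1r big1 ?add0r // => i _.
by rewrite coefXn ltn_eqF ?mul0r.
Qed.

Lemma poly_linear_ind (T : {poly F} -> Prop) :
    (forall k, T 'X^k) -> (forall a p q, T p -> T q -> T (a *: p + q)) ->
  forall p, T p.
Proof.
move=> TX Tlin p; have T0 : T 0.
  by have := Tlin (-1) _ _ (TX 0) (TX 0); rewrite scaleN1r addNr.
rewrite -[p]coefK poly_def; elim: (size p) => [|n IHn]; first by rewrite big_ord0.
by rewrite big_ord_recr /= addrC; apply: Tlin.
Qed.

(** The moment recurrence says that [K] is integration against [kap w / (x - s)], up to a point mass
    at [s]; the factor [X - s] removes both. *)
Lemma lfun_mulXsubC (m K : nat -> F) s kap f :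
    (forall k, K k.+1 = s * K k + kap * m k) ->
  lfun K (('X - s%:P) * f) = kap * lfun m f.
Proof.
move=> HK; elim/poly_linear_ind: f => [k|a p q IHp IHq].
  rewrite mulrBl -exprS mul_polyC linearB linearZ /= !lfunXn HK.
  by rewrite addrAC subrr add0r.
by rewrite mulrDr -scalerAr !linearP /= IHp IHq mulrDr mulrCA.
Qed.

Section Pearson.

Variables (m dm : nat -> F) (t al be ga : F).
Hypothesis dm_succ : forall k, dm k.+1 = t * dm k - ga * m k.
Hypothesis dmE : forall k, t * (1 - t) * dm k =
  (k%:R + 1 + al + ga - ga * t) * m k - (k%:R + 2 + al + be + ga) * m k.+1.

(* [dm] being the moments of [- ga * w / (x - t)], [mom0] and [mom1] are those of [al * w / x]
   and [be * w / (1 - x)], obtained algebraically to avoid improper integrals; hence the moments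
   of [w'] are [mom0 - mom1 - dm]. *)
Definition mom0 k : F :=
  if k is k'.+1 then al * m k' else (al + be + 1) * m 0%N + dm 0%N - dm 1%N.

Definition mom1 k : F := mom0 k - dm k + k%:R * m k.-1.

Lemma mom0_succ k : mom0 k.+1 = 0 * mom0 k + al * m k.
Proof. by rewrite mul0r add0r. Qed.

(** The value chosen for [mom0] at 0 settles [k = 0]; higher indices follow by combining the two
    relations on [dm]. *)
Lemma mom1_succ k : mom1 k.+1 = 1 * mom1 k + - be * m k.
Proof.
have H2 j : dm j.+1 - dm j.+2 =
    (j%:R + 1 + al) * m j - (j%:R + 2 + al + be) * m j.+1.
  by rewrite (dm_succ j.+1) dm_succ; apply: (eq_of_combination (c := 1) (dmE j)); ring.
case: k => [|k]; rewrite /mom1 /mom0 /=; first by rewrite mulr1n; ring.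
by apply: (eq_of_combination (c := 1) (H2 k)); ring.
Qed.

(** Integration by parts against [w']. On monomials it is the definition of [mom1]. *)
Lemma lfun_pearson f : - lfun m f^`() = lfun mom0 f - lfun mom1 f - lfun dm f.
Proof.
elim/poly_linear_ind: f => [k|a p q IHp IHq].
  rewrite derivXn linearMn /= !lfunXn /mom1 -mulr_natl; ring.
rewrite linearP /= !linearP /= opprD -mulrN IHp IHq; ring.
Qed.

Lemma lfun_pearson_t f : t * (1 - t) * lfun dm f =
  lfun m ('X * (1 - 'X) * f^`() + (1 + al + ga - ga * t) *: f
          - (2 + al + be + ga) *: ('X * f)).
Proof.
elim/poly_linear_ind: f => [k|a p q IHp IHq].
  have -> : 'X * (1 - 'X) * ('X^k : {poly F})^`() + (1 + al + ga - ga * t) *: ('X^k : {poly F})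
      - (2 + al + be + ga) *: ('X * 'X^k : {poly F})
    = (k%:R + 1 + al + ga - ga * t) *: ('X^k : {poly F})
      - (k%:R + 2 + al + be + ga) *: ('X^(k.+1) : {poly F}).
    rewrite derivXn -scaler_nat -!mul_polyC.
    by case: k => [|k]; rewrite /= ?mulr0n ?exprS; ring.
  by rewrite linearB !linearZ /= !lfunXn dmE.
rewrite linearP /= mulrDr mulrCA IHp IHq -linearP /=; congr (lfun m _).
rewrite derivD derivZ -!mul_polyC; ring.
Qed.

End Pearson.

End Functionals.

(** * The linear system of a pair of orthogonal polynomials *)

Section Orthogonality.

Variable F : fieldType.
Implicit Types (L K : {scalar {poly F}}) (f g P Q : {poly F}) (s kap t : F) (n : nat).

Definition orthog L n P := forall f, (size f <= n)%N -> L (P * f) = 0.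

(** Models integration against [kap w / (x - s)]; [K P] is then, up to a factor, the value at [s] of
    the function of the second kind of [P]. *)
Definition pole_of L s kap K := forall f, K (('X - s%:P) * f) = kap * L f.

Lemma euclid_at f n s : (size f <= n.+1)%N ->
  exists r, [/\ f = (f.[s])%:P + ('X - s%:P) * r, (size r <= n)%N
    & (0 < n)%N -> r`_n.-1 = f`_n].
Proof.
move=> le_fn; have /factor_theorem[r Er] : root (f - (f.[s])%:P) s.
  by rewrite /root hornerD hornerN hornerC subrr.
have le_rn : (size r <= n)%N.
  have [-> | nz_r] := eqVneq r 0; first by rewrite size_poly0.
  have := size_Mmonic nz_r (monicXsubC s); rewrite -Er size_XsubC addn2 /= => Es.
  rewrite -ltnS -Es (leq_trans (size_polyD _ _)) // size_polyN geq_max le_fn.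
  by rewrite (leq_trans (size_polyC_leq1 _)).
exists r; split=> //; first by rewrite mulrC -Er addrC subrK.
case: n le_fn le_rn => // n le_fn le_rn _.
move/(congr1 (fun p : {poly F} => p`_n.+1)): Er.
rewrite coefB coefC subr0 mulrBr coefB coefMX coefMC /= => ->.
by rewrite (nth_default _ le_rn) mul0r subr0.
Qed.

Lemma size_sub_lead n Q f : Q \is monic -> size Q = n.+1 -> (size f <= n.+1)%N ->
  (size (f - f`_n *: Q)%R <= n)%N.
Proof.
move=> mQ sQ le_fn; apply/leq_sizeP => j; rewrite leq_eqVlt => /orP[/eqP<- | lt_nj].
  have := monicP mQ; rewrite lead_coefE sQ /= => Qn.
  by rewrite coefB coefZ Qn mulr1 subrr.
have lt_fj : (size f <= j)%N by apply: leq_trans le_fn _.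
by rewrite coefB coefZ [f`_j]nth_default // [Q`_j]nth_default ?sQ // mulr0 subrr.
Qed.

Lemma size_deriv_leq f n : (size f <= n.+1)%N -> (size f^`() <= n)%N.
Proof.
move=> le_f; apply/leq_sizeP => j le_nj.
by rewrite coef_deriv nth_default ?mul0rn // (leq_trans le_f).
Qed.

Lemma orthog_coef L n Q f : orthog L n Q -> Q \is monic -> size Q = n.+1 ->
  (size f <= n.+1)%N -> L (Q * f) = f`_n * L (Q * Q).
Proof.
move=> oQ mQ sQ le_fn.
have -> : Q * f = f`_n *: (Q * Q) + Q * (f - f`_n *: Q).
  by rewrite mulrBr -scalerAr addrC subrK.
rewrite linearD linearZ /= [X in _ + X]oQ ?addr0 //.
exact: size_sub_lead.
Qed.

(** Division by [X - s] splits [f] into its value at [s] and a multiple of [X - s], which cancels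
    the pole and leaves a product killed by orthogonality. *)
Lemma orthog_pole L K s kap n P f : pole_of L s kap K -> orthog L n P ->
  (size f <= n.+1)%N -> K (P * f) = f.[s] * K P.
Proof.
move=> pK oP /(euclid_at s)[r [Er le_r _]].
have -> : P * f = f.[s] *: P + ('X - s%:P) * (P * r).
  by rewrite -mul_polyC {1}Er; ring.
by rewrite linearD linearZ /= pK oP // mulr0 addr0.
Qed.

Section Pair.

Variables (L : {scalar {poly F}}) (n : nat) (P Q : {poly F}).
Hypotheses (mP : P \is monic) (sP : size P = n.+2) (oP : orthog L n.+1 P).
Hypotheses (mQ : Q \is monic) (sQ : size Q = n.+1) (oQ : orthog L n Q).
Let h := L (Q * Q).

Let Pn1 : P`_n.+1 = 1. Proof. by have := monicP mP; rewrite lead_coefE sP. Qed.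
Let Qn : Q`_n = 1. Proof. by have := monicP mQ; rewrite lead_coefE sQ. Qed.

Lemma pair_orthog : L (P * Q) = 0. Proof. by apply: oP; rewrite sQ. Qed.

Lemma pole_PP K s kap : pole_of L s kap K -> K (P * P) = P.[s] * K P.
Proof. by move=> pK; apply: (orthog_pole pK oP); rewrite sP. Qed.

Lemma pole_PQ K s kap : pole_of L s kap K -> K (P * Q) = Q.[s] * K P.
Proof. by move=> pK; apply: (orthog_pole pK oP); rewrite sQ leqW. Qed.

Lemma pole_QQ K s kap : pole_of L s kap K -> K (Q * Q) = Q.[s] * K Q.
Proof. by move=> pK; apply: (orthog_pole pK oQ); rewrite sQ. Qed.

Lemma pole_XPQ K s kap : pole_of L s kap K -> K ('X * (P * Q)) = s * K (P * Q).
Proof.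
move=> pK; have -> : 'X * (P * Q) = ('X - s%:P) * (P * Q) + s *: (P * Q).
  by rewrite mulrBl mul_polyC subrK.
by rewrite linearD linearZ /= pK pair_orthog mulr0 add0r.
Qed.

(** [K (P * Q)] is evaluated in two ways, dividing either [Q] or [P] by [X - s]. *)
Lemma pole_wronskian K s kap : pole_of L s kap K ->
  Q.[s] * K P = P.[s] * K Q + kap * h.
Proof.
move=> pK; rewrite -(pole_PQ pK).
have [|r [Er le_r]] := @euclid_at P n.+1 s; first by rewrite sP.
rewrite Pn1 => /(_ isT) /= rn.
have -> : P * Q = P.[s] *: Q + ('X - s%:P) * (Q * r).
  by rewrite -mul_polyC {1}Er; ring.
by rewrite linearD linearZ /= pK (orthog_coef oQ) // rn mul1r.
Qed.

Lemma L_deriv_PQ : L (P * Q)^`() = n.+1%:R * h.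
Proof.
rewrite derivM linearD /= [X in _ + X]oP ?addr0; last by rewrite size_deriv_leq // sQ leqW.
rewrite mulrC (orthog_coef oQ) // ?size_deriv_leq ?sP //.
by rewrite coef_deriv Pn1.
Qed.

Lemma L_deriv_PP : L (P * P)^`() = 0.
Proof.
rewrite derivM linearD /= [P^`() * P]mulrC oP ?addr0 //.
by rewrite size_deriv_leq // sP.
Qed.

Lemma L_deriv_QQ : L (Q * Q)^`() = 0.
Proof.
rewrite derivM linearD /= [Q^`() * Q]mulrC oQ ?addr0 //.
by rewrite size_deriv_leq // sQ.
Qed.

Lemma L_deriv_XPQ : L ('X * (P * Q))^`() = - P`_n * h.
Proof.
(* The leading terms of the multiplier of [Q] cancel, so only its coefficient of index [n] counts,
   which is minus that of [P]. *)
have -> : ('X * (P * Q))^`() =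
    P * ((n.+1%:R + 1) *: Q + 'X * Q^`()) + Q * ('X * P^`() - n.+1%:R *: P).
  by rewrite !derivM derivX -!mul_polyC; ring.
rewrite linearD /= oP; last first.
  rewrite (leq_trans (size_polyD _ _)) // geq_max (leq_trans (size_scale_leq _ _)) ?sQ //=.
  rewrite (leq_trans (size_polyMleq _ _)) // size_polyX /= ltnS.
  by rewrite size_deriv_leq ?sQ.
have Ec j : ('X * P^`() - n.+1%:R *: P)`_j = (j%:R - n.+1%:R) * P`_j.
  rewrite coefB coefZ coefXM mulrBl; congr (_ - _); case: j => [|j] /=.
    by rewrite mul0r.
  by rewrite coef_deriv mulr_natl.
rewrite add0r (orthog_coef oQ) //; last first.
  apply/leq_sizeP => j; rewrite Ec leq_eqVlt => /orP[/eqP<- | lt_nj].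
    by rewrite subrr mul0r.
  by rewrite [P`_j]nth_default ?mulr0 // sP.
by rewrite Ec -[n.+1%:R]natr1 opprD addrA subrr add0r mulN1r.
Qed.

End Pair.
End Orthogonality.

(** * Residue matrices at 0, 1, t and their static relations *)

Section Residues.

Variables (F : fieldType) (m dm : nat -> F) (t al be ga : F).
Hypothesis dm_succ : forall k, dm k.+1 = t * dm k - ga * m k.
Hypothesis dmE : forall k, t * (1 - t) * dm k =
  (k%:R + 1 + al + ga - ga * t) * m k - (k%:R + 2 + al + be + ga) * m k.+1.

Let L : {scalar {poly F}} := lfun m.
Let D : {scalar {poly F}} := lfun dm.
Let L0 : {scalar {poly F}} := lfun (mom0 m dm al be).
Let L1 : {scalar {poly F}} := lfun (mom1 m dm al be).

Lemma poleD : pole_of L t (- ga) D.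
Proof. by move=> f; apply: lfun_mulXsubC => k; rewrite dm_succ mulNr. Qed.

Lemma pole0 : pole_of L 0 al L0.
Proof. by move=> f; apply: lfun_mulXsubC => k; apply: mom0_succ. Qed.

Lemma pole1 : pole_of L 1 (- be) L1.
Proof. by move=> f; apply: lfun_mulXsubC => k; apply: (mom1_succ dm_succ dmE). Qed.

Variables (n : nat) (P Q : {poly F}).
Hypotheses (mP : P \is monic) (sP : size P = n.+2) (oP : orthog L n.+1 P).
Hypotheses (mQ : Q \is monic) (sQ : size Q = n.+1) (oQ : orthog L n Q).
Let h := L (Q * Q).
Hypothesis nz_h : h != 0.

(** Up to sign, this is a diagonal entry of the residue matrix at [s], and the next two are its
    off-diagonal entries. *)
Definition residue_r s (K : {poly F} -> F) := Q.[s] * K P / h.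
Definition residue_s s (K : {poly F} -> F) := Q.[s] * K Q / h.
Definition residue_t s (K : {poly F} -> F) := P.[s] * K P / h.

(** The products of the values of [P], [Q] at [s] with [K P], [K Q] form a matrix of rank one; by
    [pole_wronskian] its remaining entry, divided by [h], is [residue_r s K - kap]. *)
Lemma residue_det K s kap : pole_of L s kap K ->
  residue_s s K * residue_t s K = residue_r s K * (residue_r s K - kap).
Proof.
move=> pK; have W := pole_wronskian mP sP oP mQ sQ oQ pK.
rewrite /residue_s /residue_t /residue_r.
have -> : kap = (Q.[s] * K P - P.[s] * K Q) / h.
  by rewrite W addrC addKr mulfK.
by field.
Qed.

Let rho := residue_r t D.
Let rho0 := residue_r 0 L0.
Let rho1 := residue_r 1 L1.

(** Comes from [lfun_pearson] at [P * Q]; the next two lemmas use [Q * Q] and [P * P], whose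
    derivatives are annihilated by [L]. *)
Lemma residue_r_sum : rho1 = rho0 - rho + n.+1%:R.
Proof.
have := lfun_pearson m dm al be (P * Q); rewrite -/L -/D -/L0 -/L1.
rewrite (L_deriv_PQ mP sP oP mQ sQ oQ) (pole_PQ oP sQ pole0).
rewrite (pole_PQ oP sQ pole1) (pole_PQ oP sQ poleD) -/h => E.
apply: (eq_of_combination (c := h^-1) E); rewrite /rho1 /rho0 /rho /residue_r; field; exact: nz_h.
Qed.

Lemma residue_s_sum : residue_s 1 L1 = residue_s 0 L0 - residue_s t D.
Proof.
have := lfun_pearson m dm al be (Q * Q); rewrite -/L -/D -/L0 -/L1.
rewrite (L_deriv_QQ sQ oQ) (pole_QQ sQ oQ pole0) (pole_QQ sQ oQ pole1).
rewrite (pole_QQ sQ oQ poleD) => E.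
apply: (eq_of_combination (c := h^-1) E); rewrite /residue_s; field; exact: nz_h.
Qed.

Lemma residue_t_sum : residue_t 1 L1 = residue_t 0 L0 - residue_t t D.
Proof.
have := lfun_pearson m dm al be (P * P); rewrite -/L -/D -/L0 -/L1.
rewrite (L_deriv_PP sP oP) (pole_PP sP oP pole0) (pole_PP sP oP pole1).
rewrite (pole_PP sP oP poleD) => E.
apply: (eq_of_combination (c := h^-1) E); rewrite /residue_t; field; exact: nz_h.
Qed.

(** The test polynomial ['X * (P * Q)] weights each residue by its pole, and its derivative brings
    in the subleading coefficient. *)
Lemma subleading_residues : P`_n = - (rho0 - rho + n.+1%:R + t * rho).
Proof.
have := lfun_pearson m dm al be ('X * (P * Q)); rewrite -/L -/D -/L0 -/L1.
rewrite (L_deriv_XPQ sP oP mQ sQ oQ).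
rewrite (pole_XPQ oP sQ pole0) (pole_XPQ oP sQ pole1) (pole_XPQ oP sQ poleD).
rewrite (pole_PQ oP sQ pole0) (pole_PQ oP sQ pole1) (pole_PQ oP sQ poleD) -/h => E.
rewrite -residue_r_sum.
apply: (eq_of_combination (c := h^-1) E); rewrite /rho1 /rho /residue_r; field; exact: nz_h.
Qed.

(* For a, b, c the residue matrices at 0, 1, t, the left-hand side is the square of a multiple of
   tr (a [b, c]), which is a Gram determinant of the trace form. *)
Lemma residue_gram : let N := n.+1%:R in
  (residue_t 0 L0 * residue_s t D - residue_s 0 L0 * residue_t t D) ^+ 2 =
  (2 * rho * rho0 - (al + be + 2 * N) * rho0 + (ga + be + 2 * N) * rho
     - N * (N + be)) ^+ 2 - 4 * rho * (rho + ga) * rho0 * (rho0 - al).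
Proof.
move=> N; have := residue_det poleD; have := residue_det pole0; have := residue_det pole1.
rewrite residue_s_sum residue_t_sum -/rho -/rho0 -/rho1 residue_r_sum -/N.
move: (residue_s 0 L0) (residue_t 0 L0) (residue_s t D) (residue_t t D) => S0 T0 S T.
move: rho rho0 N => r r0 N E1 E0 E.
(* Polarisation: the determinant relation at 1 involves [(S0 - S) * (T0 - T)], and those at 0 and
   [t] remove its two pure terms. *)
have EX : S * T0 + S0 * T = 2 * r * r0 - (al + be + 2 * N) * r0
    + (ga + be + 2 * N) * r - N * (N + be).
  have -> : S * T0 + S0 * T = S0 * T0 + S * T - (S0 - S) * (T0 - T) by ring.
  by rewrite E E0 E1; ring.
have -> : (T0 * S - S0 * T) ^+ 2 =
   (S * T0 + S0 * T) ^+ 2 - 4 * (S * T) * (S0 * T0) by ring.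
by rewrite EX E E0; ring.
Qed.

(** * Deformation in t and the Schlesinger equation *)

Section Deformation.

Variables (dP dQ : {poly F}).
Hypotheses (sdP : (size dP <= n.+1)%N) (sdQ : (size dQ <= n)%N).
Hypothesis odP : forall f : {poly F}, (size f <= n.+1)%N -> D (P * f) + L (dP * f) = 0.
Hypothesis odQ : forall f : {poly F}, (size f <= n)%N -> D (Q * f) + L (dQ * f) = 0.
Hypothesis nondeg : forall g : {poly F}, (size g <= n.+1)%N ->
  (forall f : {poly F}, (size f <= n.+1)%N -> L (g * f) = 0) -> g = 0.
Hypotheses (nz_t : t != 0) (nz_ga : ga != 0).

Lemma deform_subleading : dP`_n = - rho.
Proof.
have := odP (f := Q); rewrite sQ ltnSn => /(_ isT).
rewrite (pole_PQ oP sQ poleD) [dP * Q]mulrC (orthog_coef oQ) // -/h => E.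
apply: (eq_of_combination (c := h^-1) E); rewrite /rho /residue_r; field; exact: nz_h.
Qed.

(* [R / h] is the Christoffel-Darboux kernel, with one argument fixed to [t]. *)
Lemma christoffel_darboux : exists2 R : {poly F},
    ('X - t%:P) * R = Q.[t] *: P - P.[t] *: Q &
    (size R <= n.+1)%N /\ forall f : {poly F}, (size f <= n.+1)%N -> L (R * f) = h * f.[t].
Proof.
have [|R [ER le_R _]] := @euclid_at F (Q.[t] *: P - P.[t] *: Q) n.+1 t.
  rewrite (leq_trans (size_polyD _ _)) // size_polyN geq_max.
  by rewrite !(leq_trans (size_scale_leq _ _)) ?sP ?sQ.
move: ER; rewrite hornerD hornerN !hornerZ [X in X%:P + _](_ : _ = 0) ?add0r; last by ring.
move=> ER; exists R => //; split=> // f le_f.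
(* The normalisation results from the pole equation of [D] at [R] and the Wronskian, after division
   by [ga]. *)
have LR : L R = h.
  have := poleD R; rewrite -ER linearB !linearZ /= (pole_wronskian mP sP oP mQ sQ oQ poleD).
  rewrite -/h [X in X = _](_ : _ = - ga * h); last by ring.
  by move/(mulfI _) => ->//; rewrite oppr_eq0.
have [g [Ef le_g _]] := euclid_at t le_f.
have -> : R * f = f.[t] *: R + (Q.[t] *: (P * g) - P.[t] *: (Q * g)).
  rewrite {1}Ef mulrDr mulrA [R * ('X - _)]mulrC -ER -!mul_polyC; ring.
rewrite linearD linearB !linearZ /= (oQ le_g) oP ?(leq_trans le_g) // LR; ring.
Qed.

(** By [nondeg], both equations may be checked on test polynomials, where [R] acts as [h] times
    evaluation at [t]. *)
Lemma deform_poly (R : {poly F}) : (size R <= n.+1)%N ->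
    (forall f : {poly F}, (size f <= n.+1)%N -> L (R * f) = h * f.[t]) ->
  h *: dP = - D P *: R /\ h *: dQ = D Q *: (Q.[t] *: Q - R).
Proof.
move=> sR cd; split; apply/eqP; rewrite -subr_eq0; apply/eqP; apply: nondeg => [|f le_f].
- rewrite (leq_trans (size_polyD _ _)) // size_polyN geq_max.
  by rewrite !(leq_trans (size_scale_leq _ _)).
- have := odP le_f; rewrite (orthog_pole poleD oP) ?(leq_trans le_f) // => E.
  rewrite mulrBl -!scalerAl linearB !linearZ /= cd //.
  by apply: (eq_of_combination (c := h) E); ring.
- rewrite (leq_trans (size_polyD _ _)) // size_polyN geq_max.
  rewrite !(leq_trans (size_scale_leq _ _)) ?(leq_trans sdQ) //.
  rewrite (leq_trans (size_polyD _ _)) // size_polyN geq_max sR.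
  by rewrite (leq_trans (size_scale_leq _ _)) ?sQ.
(* [odQ] covers sizes up to [n] only; the component of [f] along [Q] is orthogonal to [dQ], which
   has lower degree. *)
- have Ef : L (dQ * f) = f`_n * D (Q * Q) - D (Q * f).
    set g := f - f`_n *: Q.
    have le_g : (size g <= n)%N by apply: size_sub_lead.
    have E1 (K : {scalar {poly F}}) H : K (H * f) = K (H * g) + f`_n * K (H * Q).
      by rewrite /g mulrBr -scalerAr linearB linearZ /= subrK.
    rewrite !E1 [dQ * Q]mulrC (oQ sdQ).
    by apply: (eq_of_combination (c := 1) (odQ le_g)); ring.
  rewrite mulrBl -!scalerAl mulrBl -scalerAl linearB !linearZ /= linearB !linearZ /= cd //.
  rewrite Ef (orthog_coef oQ) // -/h (orthog_pole poleD oQ le_f) (pole_QQ sQ oQ poleD); ring.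
Qed.

Lemma deform_residue (dL0 : {poly F} -> F) :
    (forall f, t * dL0 f = al * D f + ga * L0 f) ->
  (dQ.[0] * L0 P + Q.[0] * (dL0 P + L0 dP)) / h
    - Q.[0] * L0 P * (Q.[t] * D Q) / h ^+ 2 =
  (residue_t 0 L0 * residue_s t D - residue_s 0 L0 * residue_t t D) / t.
Proof.
move=> HdL0; have [R ER [sR cd]] := christoffel_darboux.
have [EP EQ] := deform_poly sR cd.
have LR : L R = h by rewrite -[R]mulr1 cd ?size_poly1 // hornerC mulr1.
have E1 : h * dQ.[0] = D Q * (Q.[t] * Q.[0] - R.[0]).
  by have := congr1 (horner^~ 0) EQ; rewrite !hornerE.
have E2 : h * L0 dP = - D P * L0 R.
  by have := congr1 L0 EP; rewrite !linearZ.
have E3 : - t * R.[0] = Q.[t] * P.[0] - P.[t] * Q.[0].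
  by have := congr1 (horner^~ 0) ER; rewrite !hornerE.
have E4 : t * L0 R = al * h - (Q.[t] * L0 P - P.[t] * L0 Q).
  have -> : al * h = L0 ((Q.[t] *: P - P.[t] *: Q) + t *: R).
    by rewrite -LR -pole0 -ER -mul_polyC polyC0; congr (L0 _); ring.
  by rewrite linearD linearB !linearZ /=; ring.
have W := pole_wronskian mP sP oP mQ sQ oQ poleD.
have E5 := HdL0 P.
have -> : dQ.[0] = D Q * (Q.[t] * Q.[0] - R.[0]) / h by rewrite -E1 mulrAC mulfV // mul1r.
have -> : R.[0] = (P.[t] * Q.[0] - Q.[t] * P.[0]) / t.
  apply: (mulfI nz_t); rewrite [RHS]mulrC divfK //.
  by apply: (eq_of_combination (c := -1) E3); ring.
have -> : L0 dP = - D P * L0 R / h by rewrite -E2 mulrAC mulfV // mul1r.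
have -> : L0 R = (al * h - (Q.[t] * L0 P - P.[t] * L0 Q)) / t by rewrite -E4 mulrAC mulfV // mul1r.
have -> : dL0 P = (al * D P + ga * L0 P) / t by rewrite -E5 mulrAC mulfV // mul1r.
(* Eliminating [ga] by the Wronskian at [t] leaves an identity of rational functions. *)
have -> : ga = (P.[t] * D Q - Q.[t] * D P) / h.
  by rewrite W -/h mulNr opprD opprK addrA subrr add0r mulfK.
rewrite /residue_t /residue_s; field.
by rewrite nz_t nz_h.
Qed.

End Deformation.
End Residues.

(** * Norms and Hankel determinants *)

Section Norms.

Variables (F : fieldType) (m dm : nat -> F) (t al be ga : F).
Hypothesis dmE : forall k, t * (1 - t) * dm k =
  (k%:R + 1 + al + ga - ga * t) * m k - (k%:R + 2 + al + be + ga) * m k.+1.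

Let L : {scalar {poly F}} := lfun m.

Definition subleading n (P : {poly F}) : F := if n is k.+1 then P`_k else 0.

(** Gives the logarithmic derivative of the norm of [P]. The next orthogonal polynomial [N] serves
    to lower the degree of the factor paired with [P]. *)
Lemma norm_deform n (P N : {poly F}) :
  P \is monic -> size P = n.+1 -> orthog L n P ->
  N \is monic -> size N = n.+2 -> orthog L n.+1 N ->
  t * (1 - t) * lfun dm (P * P) =
  (2 * n%:R + 1 + al + ga - ga * t + 2 * subleading n P
   - (2 * n%:R + 2 + al + be + ga) * (subleading n P - subleading n.+1 N)) * L (P * P).
Proof.
move=> mP sP oP mN sN oN; rewrite (lfun_pearson_t dmE).
set c0 := 1 + al + ga - ga * t; set c1 := 2 + al + be + ga.
have Pn : P`_n = 1 by have := monicP mP; rewrite lead_coefE sP.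
have Nn : N`_n.+1 = 1 by have := monicP mN; rewrite lead_coefE sN.
pose G := 2 *: ('X * ((1 - 'X) * P^`())) + c0 *: P - c1 *: ('X * P).
have G0 : G`_0 = c0 * P`_0.
  by rewrite !(coefB, coefD, coefZ, coefXM) /=; ring.
have GS j : G`_j.+1 = 2 * (j.+1%:R * P`_j.+1 - j%:R * P`_j) + c0 * P`_j.+1 - c1 * P`_j.
  rewrite !(coefB, coefD, coefZ, coefXM) /= mulrBl mul1r coefB coefXM coef_deriv.
  by case: j => [|j] /=; rewrite ?coef_deriv -!(mulr_natl P`__) //; ring.
(* This [c] cancels the coefficient of index [n.+1] in [G]; the added multiple of [N] is orthogonal
   to [P]. *)
pose c := 2 * n%:R + c1.
have -> : 'X * (1 - 'X) * (P * P)^`() + c0 *: (P * P) - c1 *: ('X * (P * P)) =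
    P * (G + c *: N) - c *: (N * P).
  by rewrite derivM /G -!mul_polyC; ring.
rewrite linearB linearZ /= -/L [X in _ - _ * X]oN ?sP // mulr0 subr0.
rewrite (orthog_coef oP) //.
  congr (_ * _); rewrite coefD coefZ /= /c.
  case: (n) Pn => [|k] Pk; first by rewrite G0 Pk /c0 /c1 /=; ring.
  by rewrite GS Pk /c0 /c1 /= -[k.+1%:R]natr1; ring.
apply/leq_sizeP => j; case: j => // j; rewrite coefD coefZ GS leq_eqVlt eqSS.
case/orP => [/eqP<- | ]; first by rewrite Pn Nn [P`__]nth_default ?sP // /c; ring.
by rewrite ltnS => lt_nj; rewrite !nth_default ?sP ?sN //; [ring | apply: leqW].
Qed.

Definition hankel n : 'M[F]_n := \matrix_(i < n, j < n) m (i + j).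

(** A unitriangular change of basis replaces the last monomial by [P], so the last row becomes zeros
    followed by the norm of [P]. *)
Lemma det_hankel_succ n (P : {poly F}) :
  P \is monic -> size P = n.+1 -> orthog L n P ->
  \det (hankel n.+1) = \det (hankel n) * L (P * P).
Proof.
move=> mP sP oP.
have Pn : P`_n = 1 by have := monicP mP; rewrite lead_coefE sP.
pose U : 'M[F]_n.+1 := \matrix_(i, j) (if i == ord_max then P`_j else (i == j)%:R).
have dU : \det U = 1.
  rewrite det_trig; last first.
    apply/is_trig_mxP => i j lt_ij; rewrite mxE.
    case: eqP lt_ij => [-> | _ lt_ij]; first by rewrite ltnNge -ltnS ltn_ord.
    by case: eqP lt_ij => // ->; rewrite ltnn.
  rewrite big1 // => i _; rewrite mxE eqxx; case: eqP => // ->; exact: Pn.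
rewrite -[LHS]mul1r -dU -det_mulmx (expand_det_row _ ord_max).
have Ulast j : (U *m hankel n.+1) ord_max j = (if j == ord_max then L (P * P) else 0).
  have -> : (U *m hankel n.+1) ord_max j = L (P * 'X^j).
    rewrite mxE -[P in RHS]coefK poly_def sP mulr_suml linear_sum /=.
    apply: eq_bigr => k _; rewrite !mxE eqxx -scalerAl -exprD linearZ /=.
    by rewrite /L /= lfunXn.
  case: eqP => [-> | ne_j].
    by rewrite (orthog_coef oP) ?size_polyXn // coefXn eqxx mul1r.
  apply: oP; rewrite size_polyXn ltn_neqAle -ltnS ltn_ord andbT.
  by apply/eqP => E; apply: ne_j; apply: val_inj.
rewrite (bigD1 ord_max) //= big1 ?addr0 => [|j /negPf ne_j]; last first.
  by rewrite Ulast ne_j mul0r.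
rewrite Ulast eqxx mulrC /cofactor -signr_odd addnn odd_double mul1r; congr (\det _ * _).
apply/matrixP => i j; rewrite !mxE (bigD1 (lift ord_max i)) //= big1 ?addr0 => [|k ne_k].
  by rewrite !mxE [_ == ord_max]eq_sym (negPf (neq_lift _ _)) eqxx mul1r !lift_max.
rewrite !mxE [lift _ _ == ord_max]eq_sym (negPf (neq_lift _ _)).
by rewrite [_ == k]eq_sym (negPf ne_k) mul0r.
Qed.

End Norms.

(** * Orthogonal polynomials from the three-term recurrence *)

Section OrthogonalSequence.

Variable F : fieldType.

(** Carries two consecutive polynomials, starting with 0 before the constant 1. The explicit
    recurrence allows differentiation in the parameter, and monicity holds for every [m]. *)
Fixpoint op_pair (m : nat -> F) n : {poly F} * {poly F} :=
  if n is n'.+1 then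
    let: (P, Q) := op_pair m n' in
    (('X - (lfun m ('X * (P * P)) / lfun m (P * P))%:P) * P
       - (lfun m (P * P) / lfun m (Q * Q)) *: Q, P)
  else (1, 0).

Definition op m n := (op_pair m n).1.

Lemma op0 m : op m 0 = 1. Proof. by []. Qed.

Lemma op1 m : op m 1 = 'X - (lfun m 'X / lfun m 1)%:P.
Proof. by rewrite /op /= !mulr1 scaler0 subr0. Qed.

Lemma opSS m n : op m n.+2 =
  ('X - (lfun m ('X * (op m n.+1 * op m n.+1)) / lfun m (op m n.+1 * op m n.+1))%:P)
    * op m n.+1
  - (lfun m (op m n.+1 * op m n.+1) / lfun m (op m n * op m n)) *: op m n.
Proof. by rewrite /op /=; case: (op_pair m n). Qed.

Lemma op_monic_size m n : op m n \is monic /\ size (op m n) = n.+1.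
Proof.
suff: (op m n \is monic /\ size (op m n) = n.+1) /\
      (op m n.+1 \is monic /\ size (op m n.+1) = n.+2) by case.
elim: n => [|n [[mQ sQ] [mP sP]]].
  by rewrite op0 op1 monic1 size_poly1 monicXsubC size_XsubC.
split=> //; rewrite opSS; set a := (X in X%:P); set b := (X in X *: _).
have mXP : ('X - a%:P) * op m n.+1 \is monic by rewrite monicMl ?monicXsubC.
have sXP : size (('X - a%:P) * op m n.+1) = n.+3.
  by rewrite size_monicM ?monicXsubC ?monic_neq0 // size_XsubC sP.
have lt : (size (- (b *: op m n))%R < size (('X - a%:P) * op m n.+1)%R)%N.
  by rewrite size_polyN (leq_ltn_trans (size_scale_leq _ _)) // sQ sXP ltnW.
by rewrite size_polyDl // sXP; split=> //; rewrite monicE lead_coefDl.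
Qed.

Lemma op_monic m n : op m n \is monic. Proof. by case: (op_monic_size m n). Qed.

Lemma size_op m n : size (op m n) = n.+1. Proof. by case: (op_monic_size m n). Qed.

Lemma op_lead m n : (op m n)`_n = 1.
Proof. by have := monicP (op_monic m n); rewrite lead_coefE size_op. Qed.

Lemma op_neq0 m n : op m n != 0. Proof. exact: monic_neq0 (op_monic m n). Qed.

Lemma op_orthog m : (forall p, p != 0 -> lfun m (p * p) != 0) ->
  forall n, orthog (lfun m) n (op m n).
Proof.
move=> nd n.
suff: orthog (lfun m) n (op m n) /\ orthog (lfun m) n.+1 (op m n.+1) by case.
elim: n => [|n [oQ oP]].
  split=> f; first by rewrite leqn0 size_poly_eq0 => /eqP->; rewrite mulr0 linear0.
  move/size1_polyC => ->; rewrite op1 mulrC mul_polyC linearZ /= linearB /=.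
  have nz1 : lfun m 1 != 0 by have := nd 1 (oner_neq0 _); rewrite mulr1.
  by rewrite -[_%:P]mulr1 mul_polyC linearZ /= divfK // subrr mulr0.
split=> // f le_f; set P := op m n.+1 in oP *; set Q := op m n in oQ *.
have nzP : lfun m (P * P) != 0 by apply/nd/op_neq0.
have nzQ : lfun m (Q * Q) != 0 by apply/nd/op_neq0.
rewrite opSS -/P -/Q; set a := (X in X%:P); set b := (X in X *: _).
(* Test polynomials of full degree reduce to lower ones and to [P]; [b] handles the former and [a]
   the latter. *)
set g := f - f`_n.+1 *: P.
have le_g : (size g <= n.+1)%N by rewrite size_sub_lead ?op_monic ?size_op.
have Lg : lfun m ((('X - a%:P) * P - b *: Q) * g) = 0.
  have -> : (('X - a%:P) * P - b *: Q) * g = P * ('X * g) - a *: (P * g) - b *: (Q * g).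
    rewrite -!mul_polyC; ring.
  rewrite 2!linearB 2!linearZ /= [X in _ - _ * X - _]oP //.
  rewrite (orthog_coef oP) ?op_monic ?size_op //; last first.
    by rewrite (leq_trans (size_polyMleq _ _)) // size_polyX.
  rewrite (orthog_coef oQ) ?op_monic ?size_op // coefXM /= /b; field; exact: nzQ.
have LP : lfun m ((('X - a%:P) * P - b *: Q) * P) = 0.
  have -> : (('X - a%:P) * P - b *: Q) * P = 'X * (P * P) - a *: (P * P) - b *: (P * Q).
    rewrite -!mul_polyC; ring.
  rewrite 2!linearB 2!linearZ /= [X in _ - _ * X]oP ?size_op // /a divfK //; ring.
set N := _ - _ in Lg LP *.
have -> : N * f = N * g + f`_n.+1 *: (N * P) by rewrite /g mulrBr -scalerAr subrK.
by rewrite linearD linearZ /= Lg LP mulr0 addr0.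
Qed.

End OrthogonalSequence.

(** * Dependence on the parameter *)

Notation der := derivable_pt_lim.

Section Calculus.

Implicit Types (f g : R -> R) (t a b c : R).

Lemma der_eq f t a b : der f t a -> a = b -> der f t b.
Proof. by move=> ? <-. Qed.

Lemma der_cst c t : der (fun=> c) t 0.
Proof. exact: derivable_pt_lim_const. Qed.

Lemma der_id t : der (fun s => s) t 1.
Proof. exact: derivable_pt_lim_id. Qed.

Lemma derD f g t a b : der f t a -> der g t b -> der (fun s => f s + g s) t (a + b).
Proof. exact: derivable_pt_lim_plus. Qed.

Lemma derB f g t a b : der f t a -> der g t b -> der (fun s => f s - g s) t (a - b).
Proof. exact: derivable_pt_lim_minus. Qed.

Lemma derM f g t a b :
  der f t a -> der g t b -> der (fun s => f s * g s) t (a * g t + f t * b).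
Proof. exact: derivable_pt_lim_mult. Qed.

Lemma derZ c f t a : der f t a -> der (fun s => c * f s) t (c * a).
Proof. exact: derivable_pt_lim_scal. Qed.

Lemma derV_mul f g t a b : der f t a -> der g t b -> g t != 0 ->
  der (fun s => f s / g s) t (a / g t - f t * b / g t ^+ 2).
Proof.
move=> df dg nz; have dfg := derivable_pt_lim_div f g t a b df dg (elimN eqP nz).
by apply: (der_eq (f := fun s => f s / g s)) dfg _; rewrite /Rsqr !RealsE; field.
Qed.

Lemma der_sum n (f : 'I_n -> R -> R) (a : 'I_n -> R) t :
  (forall i, der (f i) t (a i)) -> der (fun s => \sum_(i < n) f i s) t (\sum_(i < n) a i).
Proof.
elim: n f a => [|n IHn] f a df.
  rewrite big_ord0; apply: (derivable_pt_lim_ext (fun=> 0)) (der_cst 0 t) => s.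
  by rewrite big_ord0.
rewrite big_ord_recl.
apply: (derivable_pt_lim_ext (fun s => f ord0 s + \sum_(i < n) f (lift ord0 i) s)).
  by move=> s; rewrite big_ord_recl.
by apply: derD => //; apply: IHn.
Qed.

Lemma der_unique f t a b : der f t a -> der f t b -> a = b.
Proof. exact: uniqueness_limite. Qed.

End Calculus.

Section PolynomialFamilies.

Implicit Types (P Q : R -> {poly R}) (t : R).

Definition pder P t (dP : {poly R}) := forall k, der (fun s => (P s)`_k) t dP`_k.

Lemma pder_cst (p : {poly R}) t : pder (fun=> p) t 0.
Proof. by move=> k; rewrite coef0; apply: der_cst. Qed.

Lemma pderB P Q t dP dQ : pder P t dP -> pder Q t dQ ->
  pder (fun s => P s - Q s) t (dP - dQ).
Proof.
move=> HP HQ k; rewrite coefB.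
apply: (derivable_pt_lim_ext (fun s => (P s)`_k - (Q s)`_k)).
  by move=> s; rewrite coefB.
exact: derB.
Qed.

Lemma pderM P Q t dP dQ : pder P t dP -> pder Q t dQ ->
  pder (fun s => P s * Q s) t (dP * Q t + P t * dQ).
Proof.
move=> HP HQ k; rewrite coefD !coefM -big_split /=.
apply: (derivable_pt_lim_ext (fun s => \sum_(i < k.+1) (P s)`_i * (Q s)`_(k - i))).
  by move=> s; rewrite coefM.
by apply: (der_sum (f := fun i s => (P s)`_i * (Q s)`_(k - i))) => i; apply: derM.
Qed.

Lemma pderC (c : R -> R) t dc : der c t dc -> pder (fun s => (c s)%:P) t dc%:P.
Proof.
move=> Hc [|k]; rewrite coefC /=.
  by apply: (derivable_pt_lim_ext c) Hc => s; rewrite coefC.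
by apply: (derivable_pt_lim_ext (fun=> 0)) (der_cst 0 t) => s; rewrite coefC.
Qed.

Lemma pder_coef_cst P t dP k c : pder P t dP -> (forall s, (P s)`_k = c) -> dP`_k = 0.
Proof.
move=> HP Pk; apply: der_unique (HP k) _.
by apply: (derivable_pt_lim_ext (fun=> c)) (der_cst c t) => s; rewrite Pk.
Qed.

Lemma pder_size P t dP n :
  pder P t dP -> (forall s, (size (P s) <= n)%N) -> (size dP <= n)%N.
Proof.
move=> HP le_n; apply/leq_sizeP => j le_nj.
by apply: (pder_coef_cst (c := 0) HP) => s; rewrite nth_default // (leq_trans (le_n s)).
Qed.

Lemma pder_size_monic P t dP n : pder P t dP -> (forall s, P s \is monic) ->
  (forall s, size (P s) = n.+1) -> (size dP <= n)%N.
Proof.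
move=> HP mP sP; apply/leq_sizeP => j; rewrite leq_eqVlt => /orP[/eqP<- | lt_nj].
  apply: (pder_coef_cst (c := 1) HP) => s.
  by have := monicP (mP s); rewrite lead_coefE sP.
have := pder_size (n := n.+1) HP; move/(_ (fun s => eq_leq (sP s))) => le_d.
by rewrite nth_default // (leq_trans le_d).
Qed.

(** The uniform bound on sizes gives a sum of fixed length, to which the product rule applies
    termwise. *)
Lemma der_lfun (m : R -> nat -> R) (dm : nat -> R) P t dP n :
    (forall k, der (fun s => m s k) t (dm k)) -> pder P t dP ->
    (forall s, (size (P s) <= n)%N) ->
  der (fun s => lfun (m s) (P s)) t (lfun dm (P t) + lfun (m t) dP).
Proof.
move=> Hm HP le_n; rewrite !(lfun_widen (N := n)) ?(pder_size HP) // -big_split /=.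
apply: (derivable_pt_lim_ext (fun s => \sum_(i < n) (P s)`_i * m s i)).
  by move=> s; rewrite (lfun_widen (N := n)).
apply: der_eq (der_sum (f := fun i s => (P s)`_i * m s i)
  (a := fun i => dP`_i * m t i + (P t)`_i * dm i) _) _ => [i|].
  exact: derM.
by apply: eq_bigr => i _; rewrite addrC.
Qed.

End PolynomialFamilies.

(** * Flow of the polynomials, residues and Hankel determinants in t *)

Section MomentFlow.

Variables (m dm : R -> nat -> R) (al be ga : R).
Hypothesis m_der : forall t k, in01 t -> der (fun s => m s k) t (dm t k).
Hypothesis dm_succ : forall t k, in01 t -> dm t k.+1 = t * dm t k - ga * m t k.
Hypothesis dmE : forall t k, in01 t -> t * (1 - t) * dm t k =
  (k%:R + 1 + al + ga - ga * t) * m t k - (k%:R + 2 + al + be + ga) * m t k.+1.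
Hypothesis m_pos : forall t (p : {poly R}), in01 t -> p != 0 -> Rlt 0 (lfun (m t) (p * p)).
Hypothesis nz_ga : ga != 0.

Let L t : {scalar {poly R}} := lfun (m t).
Let D t : {scalar {poly R}} := lfun (dm t).
Let L0 t : {scalar {poly R}} := lfun (mom0 (m t) (dm t) al be).
Let P n s := op (m s) n.
Let h n s := L s (P n s * P n s).

Lemma m_nondeg t : in01 t -> forall p : {poly R}, p != 0 -> lfun (m t) (p * p) != 0.
Proof. by move=> t01 p nz_p; apply/eqP/Rgt_not_eq/m_pos. Qed.

Lemma P_orthog n t : in01 t -> orthog (L t) n (P n t).
Proof. by move=> t01; apply/op_orthog/m_nondeg. Qed.

Lemma h_neq0 n t : in01 t -> h n t != 0.
Proof. by move=> t01; apply/m_nondeg/op_neq0. Qed.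

Lemma size_PP n k s : (size (P n s * P k s)%R <= n + k.+1)%N.
Proof. by rewrite (leq_trans (size_polyMleq _ _)) // !size_op addSn /=. Qed.

(** Induction along the three-term recurrence, whose denominators are norms and do not vanish on the
    unit interval. *)
Lemma pder_P n t : in01 t -> exists dP, pder (P n) t dP.
Proof.
move=> t01; have mt k := m_der k t01.
suff: (exists dP, pder (P n) t dP) /\ (exists dP, pder (P n.+1) t dP) by case.
elim: n => [|n [[dQ HQ] [dP HP]]].
  split; first by exists 0; apply: pder_cst.
  eexists => k; apply: derivable_pt_lim_ext => [s|]; first by rewrite /P op1.
  move: k; apply: (pderB (pder_cst 'X t)); apply: pderC; apply: derV_mul.
  - by apply: (der_lfun mt (pder_cst 'X t) (n := 2)) => s; rewrite size_polyX.
  - by apply: (der_lfun mt (pder_cst 1 t) (n := 1)) => s; rewrite size_poly1.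
  - by have := m_nondeg t01 (oner_neq0 _); rewrite mulr1.
split; first by exists dP.
have Hh k dR : pder (P k) t dR -> exists a, der (h k) t a.
  move=> HR; eexists; exact: (der_lfun mt (pderM HR HR) (size_PP k k)).
have [[a Ha] [b Hb]] := (Hh _ _ HP, Hh _ _ HQ).
have sX s : (size ('X * (P n.+1 s * P n.+1 s))%R <= n.+1 + n.+3)%N.
  by rewrite (leq_trans (size_polyMleq _ _)) // size_polyX /= addnS ltnS size_PP.
have Hc := der_lfun mt (pderM (pder_cst 'X t) (pderM HP HP)) sX.
eexists => k; apply: derivable_pt_lim_ext => [s|]; first by rewrite /P opSS -mul_polyC.
move: k; apply: pderB; last first.
  by apply: (pderM (pderC (derV_mul Ha Hb _)) HQ); apply: h_neq0.
apply: (pderM (pderB (pder_cst 'X t) (pderC (derV_mul Hc Ha _))) HP); exact: h_neq0.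
Qed.

(** The derivative of [P n] has degree below [n] and is orthogonal to [P n]. *)
Lemma der_h n t : in01 t -> der (h n) t (D t (P n t * P n t)).
Proof.
move=> t01; have [dP HP] := pder_P n t01.
apply: der_eq (der_lfun (fun k => m_der k t01) (pderM HP HP) (size_PP n n)) _.
rewrite linearD /= -/(L t) [dP * _]mulrC.
rewrite (P_orthog t01) ?addr0 //; apply: pder_size_monic HP _ _ => s;
  [exact: op_monic | exact: size_op].
Qed.

Lemma nondegenerate t n (g : {poly R}) : in01 t -> (size g <= n)%N ->
  (forall f : {poly R}, (size f <= n)%N -> L t (g * f) = 0) -> g = 0.
Proof.
move=> t01 le_g Hg; apply/eqP; apply: contraT => nz_g.
by have := m_nondeg t01 nz_g; rewrite [lfun _ _]Hg ?eqxx.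
Qed.

Lemma P_deform n t dP (f : {poly R}) : in01 t -> pder (P n) t dP -> (size f <= n)%N ->
  D t (P n t * f) + L t (dP * f) = 0.
Proof.
move=> t01 HP le_f.
have sPf s : (size (P n s * f)%R <= n + n)%N.
  by rewrite (leq_trans (size_polyMleq _ _)) // size_op addSn /= leq_add2l.
have := der_lfun (fun k => m_der k t01) (pderM HP (pder_cst f t)) sPf.
rewrite mulr0 addr0 => H; apply: der_unique H _.
apply: derivable_pt_lim_ext01 t01 (der_cst 0 t) => s s01.
by rewrite [RHS](P_orthog s01).
Qed.

Definition dmom0 t k :=
  if k is k'.+1 then al * dm t k' else (al * dm t 0 + ga * mom0 (m t) (dm t) al be 0) / t.

(** Trades [dm] for moments, whose derivatives are known. *)
Lemma mom0_zeroE t : in01 t -> mom0 (m t) (dm t) al be 0 =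
  ((1 + al + ga + (al + be + 1) * t) * m t 0 - (2 + al + be + ga) * m t 1) / t.
Proof.
move=> t01; have /eqP nz_t := in01_neq0 _ t01.
apply: (mulIf nz_t); rewrite divfK //=.
have E := dmE 0 t01; rewrite dm_succ //.
by apply: (eq_of_combination (c := 1) E); ring.
Qed.

Lemma der_mom0 t k : in01 t ->
  der (fun s => mom0 (m s) (dm s) al be k) t (dmom0 t k).
Proof.
move=> t01; have /eqP nz_t := in01_neq0 _ t01.
case: k => [|k]; last by apply: derZ; apply: m_der.
pose f s := ((1 + al + ga + (al + be + 1) * s) * m s 0 - (2 + al + be + ga) * m s 1) / s.
apply: (derivable_pt_lim_ext01 f _ t _ _ t01); first by move=> s s01; rewrite mom0_zeroE.
apply: der_eq (derV_mul (derB (derM (derD (der_cst _ t)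
   (derZ _ (der_id t))) (m_der 0 t01))
   (derZ _ (m_der 1 t01))) (der_id t) nz_t) _.
rewrite /dmom0 mom0_zeroE //.
have E := dmE 0 t01; rewrite dm_succ // in E *.
by apply: (eq_of_combination (c := (1 + ga) / t ^+ 2) E); field.
Qed.

(** Partial fractions: the derivative of [al w / x] in [t] is [- al ga w / (x (x - t))], and
    [t / (x (x - t)) = 1 / (x - t) - 1 / x]. *)
Lemma lfun_dmom0 t (f : {poly R}) : in01 t ->
  t * lfun (dmom0 t) f = al * D t f + ga * L0 t f.
Proof.
move=> t01; have /eqP nz_t := in01_neq0 _ t01.
elim/poly_linear_ind: f => [k|a p q IHp IHq].
  rewrite /D /L0 /= !lfunXn; case: k => [|k] /=; first by rewrite mulrC divfK.
  by rewrite dm_succ //; ring.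
rewrite !linearP /= !mulrDr mulrCA IHp IHq; ring.
Qed.

Let rho n t := residue_r (m t) (P n.+1 t) (P n t) t (D t).
Let rho0 n t := residue_r (m t) (P n.+1 t) (P n t) 0 (L0 t).
Let drho0 n t :=
  (residue_t (m t) (P n.+1 t) (P n t) 0 (L0 t) * residue_s (m t) (P n t) t (D t)
   - residue_s (m t) (P n t) 0 (L0 t) * residue_t (m t) (P n.+1 t) (P n t) t (D t)) / t.

Lemma pder_P_size n t dP : pder (P n) t dP -> (size dP <= n)%N.
Proof.
by move=> HP; apply: pder_size_monic HP _ _ => s; [exact: op_monic | exact: size_op].
Qed.

Lemma der_subleading n t : in01 t -> der (fun s => (P n.+1 s)`_n) t (- rho n t).
Proof.
move=> t01; have [dP HP] := pder_P n.+1 t01.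
rewrite -(deform_subleading (fun k => dm_succ k t01) (P_orthog (n := n.+1) t01) (op_monic _ _)
  (size_op _ _) (P_orthog (n := n) t01) (h_neq0 n t01) (pder_P_size HP)).
  exact: HP.
by move=> f; apply: P_deform.
Qed.

Lemma subleading_rho n t : in01 t ->
  (P n.+1 t)`_n = - (rho0 n t - rho n t + n.+1%:R + t * rho n t).
Proof.
move=> t01; exact: (subleading_residues (fun k => dm_succ k t01) (fun k => dmE k t01)
  (op_monic _ _) (size_op _ _) (P_orthog (n := n.+1) t01) (op_monic _ _) (size_op _ _)
  (P_orthog (n := n) t01) (h_neq0 n t01)).
Qed.

Lemma der_rho0 n t : in01 t -> der (rho0 n) t (drho0 n t).
Proof.
move=> t01; have [dP HP] := pder_P n.+1 t01; have [dQ HQ] := pder_P n t01.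
have /eqP nz_t := in01_neq0 _ t01.
have E := deform_residue (fun k => dm_succ k t01) (op_monic _ _) (size_op _ _)
  (P_orthog (n := n.+1) t01) (op_monic _ _) (size_op _ _) (P_orthog (n := n) t01) (h_neq0 n t01)
  (pder_P_size HP) (pder_P_size HQ) (fun f le_f => P_deform t01 HP le_f)
  (fun f le_f => P_deform t01 HQ le_f) (fun g le_g => nondegenerate t01 le_g) nz_t nz_ga
  (fun f => lfun_dmom0 f t01).
rewrite /drho0 -[RHS in der _ _ RHS]E.
have HQ0 : der (fun s => (P n s).[0]) t dQ.[0].
  rewrite horner_coef0; apply: derivable_pt_lim_ext (HQ 0) => s.
  by rewrite horner_coef0.
have sP s : (size (P n.+1 s) <= n.+2)%N by rewrite size_op.
have HL0 := der_lfun (fun k => der_mom0 k t01) HP sP.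
apply: der_eq (derV_mul (derM HQ0 HL0) (der_h n t01) (h_neq0 n t01)) _.
rewrite /h /D (pole_QQ (size_op _ _) (P_orthog (n := n) t01) (poleD (fun k => dm_succ k t01))).
by [].
Qed.

(** [subleading_rho] is solved for [rho]; on differentiating, the terms in [rho] cancel and [drho0]
    remains. *)
Lemma der_rho n t : in01 t -> der (rho n) t (drho0 n t / (1 - t)).
Proof.
move=> t01; have nz_t : 1 - t != 0 by apply/eqP/in01_neq1.
pose f s := ((P n.+1 s)`_n + n.+1%:R + rho0 n s) / (1 - s).
apply: (derivable_pt_lim_ext01 f _ t _ _ t01) => [s s01|].
  have nz_s : 1 - s != 0 by apply/eqP/in01_neq1.
  by rewrite /f subleading_rho //; field.
apply: der_eq (derV_mul (derD (derD (der_subleading n t01) (der_cst _ t)) (der_rho0 n t01))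
  (derB (der_cst _ t) (der_id t)) nz_t) _.
by rewrite subleading_rho //; field.
Qed.

Lemma rho_gram n t : in01 t -> let N := n.+1%:R in
  (t * drho0 n t) ^+ 2 =
  (2 * rho n t * rho0 n t - (al + be + 2 * N) * rho0 n t + (ga + be + 2 * N) * rho n t
     - N * (N + be)) ^+ 2 - 4 * rho n t * (rho n t + ga) * rho0 n t * (rho0 n t - al).
Proof.
move=> t01 N; have /eqP nz_t := in01_neq0 _ t01.
rewrite /drho0 [t * _]mulrC divfK //.
exact: (residue_gram (fun k => dm_succ k t01) (fun k => dmE k t01)
  (op_monic _ _) (size_op _ _) (P_orthog (n := n.+1) t01) (op_monic _ _) (size_op _ _)
  (P_orthog (n := n) t01) (h_neq0 n t01)).
Qed.

Lemma det_hankel_gt0 n t : in01 t -> Rlt 0 (\det (hankel (m t) n)).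
Proof.
move=> t01; elim: n => [|n IHn]; first by rewrite det_mx00; exact: Rlt_0_1.
rewrite (det_hankel_succ (op_monic _ _) (size_op _ _) (P_orthog (n := n) t01)).
by apply: Rmult_lt_0_compat => //; apply/m_pos/op_neq0.
Qed.

(** Each step of the induction adds the logarithmic derivative of one norm, and the sum telescopes
    by [norm_deform]. *)
Lemma der_ln_hankel n t : in01 t ->
  der (fun s => ln (\det (hankel (m s) n))) t
   ((n%:R * (n%:R + al + ga - ga * t)
     + (2 * n%:R + al + be + ga) * subleading n (P n t)) / (t * (1 - t))).
Proof.
move=> t01; have /eqP nz_t := in01_neq0 _ t01; have nz_t1 : 1 - t != 0 by apply/eqP/in01_neq1.
elim: n => [|n IHn].
  apply: (derivable_pt_lim_ext (fun=> 0)) => [s|]; first by rewrite det_mx00 ln_1.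
  by apply: der_eq (der_cst 0 t) _; rewrite /=; field; rewrite nz_t nz_t1.
apply: (derivable_pt_lim_ext01 (fun s => ln (\det (hankel (m s) n)) + ln (h n s))
  _ t _ _ t01) => [s s01|].
  rewrite (det_hankel_succ (op_monic _ _) (size_op _ _) (P_orthog (n := n) s01)).
  by rewrite [RHS]ln_mult //; [apply: det_hankel_gt0 | apply/m_pos/op_neq0].
have Hl : der (fun s => ln (h n s)) t ((h n t)^-1 * D t (P n t * P n t)).
  apply: (derivable_pt_lim_comp (h n) ln); first exact: der_h.
  by apply: derivable_pt_lim_ln; apply/m_pos/op_neq0.
apply: der_eq (derD IHn Hl) _.
have nz_h := h_neq0 n t01.
have E := norm_deform (fun k => dmE k t01) (op_monic (m t) n) (size_op _ _) (P_orthog (n := n) t01)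
  (op_monic (m t) n.+1) (size_op _ _) (P_orthog (n := n.+1) t01).
rewrite -/(D t) -/(P n t) -/(P n.+1 t) -/(L t) -/(h n t) in E.
have -> : D t (P n t * P n t) = t * (1 - t) * D t (P n t * P n t) / (t * (1 - t)).
  by field; rewrite nz_t nz_t1.
by rewrite E -[n.+1%:R]natr1; field; rewrite nz_t nz_t1 nz_h.
Qed.

End MomentFlow.

(** * Return to the given determinant and weight *)

Lemma det_matrix n (M : nat -> nat -> R) : det n M = \det (\matrix_(i < n, j < n) M i j).
Proof.
elim: n M => [|n IHn] M; first by rewrite det_mx00.
rewrite (expand_det_row _ ord0) /= sum_f_R0E big_mkord; apply: eq_bigr => j _.
rewrite IHn /cofactor mxE !RealsE /= add0n mulrCA -mulrA; congr (_ * (_ * \det _)).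
apply/matrixP => i k; rewrite !mxE /= /bump /= add1n.
congr (M _ _); case: (PeanoNat.Nat.ltb_spec k j) => [/ssrnat.ltP lt_kj|/ssrnat.leP le_jk].
  by rewrite leqNgt lt_kj.
by rewrite le_jk.
Qed.

Lemma poly_nonroot (p : {poly R}) (a b : R) : p != 0 -> Rlt a b ->
  exists x, (Rlt a x /\ Rlt x b) /\ p.[x] <> 0.
Proof.
(* These points are distinct and lie strictly between [a] and [b], so [size p] of them cannot all be
   roots. *)
move=> nz_p lt_ab; pose pt k : R := a + (b - a) / k.+2%:R.
have nzk k : k.+2%:R != 0 :> R by rewrite pnatr_eq0.
have pt_in k : Rlt a (pt k) /\ Rlt (pt k) b.
  move/RltP: lt_ab => lt_ab; have lt0 : 0 < b - a by rewrite subr_gt0.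
  split; apply/RltP; rewrite /pt ?ltrDl ?divr_gt0 ?ltr0n //.
  by rewrite -ltrBrDl ltr_pdivrMr ?ltr0n // -[X in X < _]mulr1 ltr_pM2l // ltr1n.
have pt_inj : injective pt.
  move=> i j /addrI Eij; have nz : b - a != 0.
    by rewrite subr_eq0; apply/eqP => Eba; move: lt_ab; rewrite Eba => /Rlt_irrefl.
  move/(mulfI nz)/invr_inj/eqP: Eij; rewrite eqr_nat => /eqP[]; exact.
case: (boolP (all (root p) [seq pt k | k <- iota 0 (size p)])) => [rts | /allPn[x]].
  have := max_poly_roots nz_p rts; rewrite map_inj_uniq // iota_uniq size_map size_iota.
  by rewrite ltnn => /(_ isT).
case/mapP => k _ -> /rootP nz; exists (pt k); split=> //.
Qed.

Section Bridge.

Variables (al be ga A B : R).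
Hypotheses (Hal : Rlt 0 al) (Hbe : Rlt 0 be) (Hga : Rlt 0 ga).
Hypotheses (HA : Rle 0 A) (HAB : Rle 0 (A + B)) (Hnz : ~ (A = 0 /\ A + B = 0)).

Let m := moment al be ga A B.
Let dm := dmoment al be ga A B.

Lemma moment_lfun_pos t (p : {poly R}) : in01 t -> p != 0 ->
  Rlt 0 (lfun (m t) (p * p)).
Proof.
move=> t01 nz_p; set q := p * p.
(* The left sum includes the index [size q], where the coefficient is 0. *)
have Eq (c : nat -> R) :
    sum_f_R0 (fun k => Rmult q`_k (c k)) (size q) = \sum_(k < size q) q`_k * c k.
  by rewrite sum_f_R0E big_nat_recr //= nth_default // RmultE mul0r addr0 big_mkord.
rewrite /lfun -Eq.
apply: (moment_positive _ _ _ _ _ Hal Hbe Hga HA HAB Hnz _ _ (fun x => p.[x])) => //.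
  move=> x; rewrite RmultE -hornerM -/q horner_coef Eq.
  by apply: eq_bigr => k _; rewrite RpowE.
by move=> a b lt_ab; apply: poly_nonroot.
Qed.

Lemma Dn_hankel n t : Dn al be ga A B n t = \det (hankel (m t) n).
Proof. by rewrite /Dn det_matrix. Qed.

Lemma moment_der t k : in01 t -> derivable_pt_lim (fun s => m s k) t (dm t k).
Proof. by move=> t01; apply/is_derive_Reals/moment_derive. Qed.

Lemma dmoment_succE t k : in01 t -> dm t k.+1 = t * dm t k - ga * m t k.
Proof. by move=> t01; rewrite /dm dmoment_succ. Qed.

Lemma dmomentE t k : in01 t -> t * (1 - t) * dm t k =
  (k%:R + 1 + al + ga - ga * t) * m t k - (k%:R + 2 + al + be + ga) * m t k.+1.
Proof.
move=> t01; have nz_t : t != 0 by apply/eqP/in01_neq0.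
have nz_t1 : 1 - t != 0 by apply/eqP/in01_neq1.
rewrite /dm /dmoment !RealsE /= -/m [LHS]mulrC divfK ?mulf_neq0 //.
Qed.

Lemma tau_system n : exists pp rho rho0 drho0 : R -> R,
  forall t, in01 t -> tau_equations al be ga (fun s => Dn al be ga A B n.+1 s) (INR n.+1)
    pp rho rho0 drho0 t.
Proof.
have nz_ga : ga != 0 by apply/eqP => E; move: Hga; rewrite E => /Rlt_irrefl.
exists (fun s => (op (m s) n.+1)`_n).
exists (fun t => residue_r (m t) (op (m t) n.+1) (op (m t) n) t (lfun (dm t))).
exists (fun t => residue_r (m t) (op (m t) n.+1) (op (m t) n) 0
  (lfun (mom0 (m t) (dm t) al be))).
(* The fourth witness is fixed by unification with [der_rho]. *)
eexists => t t01; split; [|split; [|split; [|split]]].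
- apply: (derivable_pt_lim_ext (fun s => ln (\det (hankel (m s) n.+1)))).
    by move=> s; rewrite Dn_hankel.
  apply: der_eq (der_ln_hankel moment_der dmomentE moment_lfun_pos n.+1 t01) _.
  by rewrite !RealsE.
- exact: (der_subleading moment_der dmoment_succE moment_lfun_pos n t01).
- exact: (der_rho moment_der dmoment_succE dmomentE moment_lfun_pos nz_ga n t01).
- by rewrite (subleading_rho dmoment_succE dmomentE moment_lfun_pos n t01) !RealsE.
- have := rho_gram dmoment_succE dmomentE moment_lfun_pos n t01.
  by rewrite !RealsE.
Qed.

End Bridge.

End OrthogonalPolynomials.

(** * From the differential system to the sigma form *)

Theorem theorem3p4 (al be ga A B : R) (n : nat)
  (Hal : 0 < al) (Hbe : 0 < be) (Hga : 0 < ga)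
  (HA : 0 <= A) (HAB : 0 <= A + B) (Hnz : ~ (A = 0 /\ A + B = 0))
  (Hn : (1 <= n)%nat) :
  let N := INR n in
  let c1 := - N * (N + al + be + ga) - (al + be) ^ 2 / 4 in
  let c2 := / 4 * (2 * N * (N + al + be + ga) + (al + be) * be - (al - be) * ga) in
  let nu1 := (al + be) / 2 in
  let nu2 := (be - al) / 2 in
  let nu3 := (2 * N + al + be) / 2 in
  let nu4 := (2 * N + al + be + 2 * ga) / 2 in
  (* L t = d/dt ln D_n(t) *)
  exists L : R -> R,
    (forall t, 0 < t < 1 ->
       derivable_pt_lim (fun s => ln (Dn al be ga A B n s)) t (L t)) /\
    let sigma := fun t => t * (t - 1) * L t + c1 * t + c2 in
    exists s1 s2 : R -> R,
      forall t, 0 < t < 1 ->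
        derivable_pt_lim sigma t (s1 t) /\
        derivable_pt_lim s1 t (s2 t) /\
        s1 t * (t * (t - 1) * s2 t) ^ 2
        + (2 * s1 t * (t * s1 t - sigma t) - (s1 t) ^ 2 - nu1 * nu2 * nu3 * nu4) ^ 2
        = (s1 t + nu1 ^ 2) * (s1 t + nu2 ^ 2) * (s1 t + nu3 ^ 2) * (s1 t + nu4 ^ 2).
Proof.
  destruct n as [|n]; [lia|].
  destruct (OrthogonalPolynomials.tau_system Hal Hbe Hga HA HAB Hnz n)
    as [pp [rho [rho0 [drho0 Htau]]]].
  intros N c1 c2 nu1 nu2 nu3 nu4.
  set (c := 2 * N + al + be + ga).
  exists (fun t => (N * (N + al + ga - ga * t) + c * pp t) / (t * (1 - t))).
  split; [intros t Ht; apply Htau; exact Ht|].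
  intros sigma.
  (* The factor [t (t - 1)] cancels the denominator up to sign, which makes [sigma] affine in
     [pp]. *)
  assert (Hsigma : forall t, in01 t ->
    sigma t = - (N * (N + al + ga - ga * t) + c * pp t) + c1 * t + c2).
  { intros t [H0 H1]; unfold sigma; field; lra. }
  (* Obtained by differentiating [Hsigma], with [- rho] as derivative of [pp] and [drho0 / (1 - t)]
     as that of [rho]. *)
  exists (fun t => N * ga + c * rho t + c1), (fun t => c * (drho0 t / (1 - t))).
  intros t Ht; destruct (Htau t Ht) as [_ [Hpp [Hrho [Epp Egram]]]].
  fold N in Epp, Egram.
  repeat split.
  - apply derivable_pt_lim_ext01 with
      (fun t => - (N * (N + al + ga - ga * t) + c * pp t) + c1 * t + c2); [|exact Ht|].
    { intros s Hs; symmetry; now apply Hsigma. }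
    apply is_derive_Reals in Hpp; apply is_derive_Reals.
    auto_derive; [repeat split; eexists; exact Hpp|].
    replace (Derive _ t) with (- rho t) by (symmetry; now apply is_derive_unique); ring.
  - apply is_derive_Reals in Hrho; apply is_derive_Reals.
    auto_derive; [repeat split; eexists; exact Hrho|].
    replace (Derive _ t) with (drho0 t / (1 - t))
      by (symmetry; now apply is_derive_unique); ring.
  (* Once [pp] and the square of [drho0] are eliminated, a polynomial identity in [rho t], [rho0 t],
     [t] and the parameters remains. *)
  - rewrite Hsigma, Epp by exact Ht.
    assert (E : (t * (t - 1) * (c * (drho0 t / (1 - t)))) ^ 2 = c ^ 2 * (t * drho0 t) ^ 2)
      by (field; destruct Ht; lra).
    rewrite E, Egram; unfold c1, c2, nu1, nu2, nu3, nu4, c; field.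
Qed.
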